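(* Let $p(\cdot)\in\mathcal{P}$ with $p(\cdot)\in LH$. Then, for any $\mathbb{W}\in A_\infty$, $w:=[\mathbb{W}(\cdot)]^{\frac{1}{p(\cdot)}}\in\mathcal{A}_{p(\cdot),\infty}$; moreover, there exist positive constants $C$ and $A$, depending only on $p(\cdot)$ and $n$, such that $$[w]_{\mathcal{A}_{p(\cdot),\infty}}\le C\,\widetilde{L_w}\,[\mathbb{W}]_{A_\infty}^A,\qquad\text{where}\quad \widetilde{L_w}:=\max\left\{[\mathbb{W}(Q_0)]^{\frac1{p_-}-\frac1{p_+}},\ [\mathbb{W}(Q_0)]^{\frac1{p_+}-\frac1{p_-}}\right\}.$$
   Context: Everything is on $\mathbb{R}^n$. $\mathcal{P}$ is the set of measurable $p:\mathbb{R}^n\to[1,\infty]$; $p_-$ and $p_+$ are the essential infimum and supremum of $p$ over $\mathbb{R}^n$. A measurable real-valued function $r$ on $\mathbb{R}^n$ belongs to $LH$ if there is $C_0>0$ with $|r(x)-r(y)|\le -\frac{C_0}{\log|x-y|}$ whenever $|x-y|<\frac12$, and there are positive constants $r_\infty,C_\infty$ with $|r(x)-r_\infty|\le\frac{C_\infty}{\log(e+|x|)}$ for all $x$. A constant ''depends only on $p(\cdot)$'' if it depends only on $p_-,p_+,p_\infty,C_0,C_\infty$; in particular such constants do not depend on $\mathbb{W}$. For a measurable function $f$, $\|f\|_{L^{p(\cdot)}}:=\inf\{\lambda>0:\int_{\mathbb{R}^n}|f(x)/\lambda|^{p(x)}\,dx\le1\}$ (with $\inf\emptyset=\infty$). Cubes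 have finite positive edge length and edges parallel to the axes (not necessarily open or closed); $\fint_Q$ denotes the average $\frac1{|Q|}\int_Q$; $Q_0$ is the cube centered at the origin with edge length $2e$, and $\mathbb{W}(Q_0):=\int_{Q_0}\mathbb{W}(x)\,dx$. A scalar weight is a non-negative measurable function on $\mathbb{R}^n$ that is positive almost everywhere. A scalar weight $v$ is in $A_\infty$ if $[v]_{A_\infty}:=\sup_Q\fint_Qv(x)\,dx\,\exp\left(\fint_Q\log(v^{-1}(x))\,dx\right)<\infty$, and $w$ is in $\mathcal{A}_{p(\cdot),\infty}$ if $$[w]_{\mathcal{A}_{p(\cdot),\infty}}:=\sup_Q\frac{1}{\|\mathbf{1}_Q\|_{L^{p(\cdot)}}}\|w\mathbf{1}_Q\|_{L^{p(\cdot)}}\exp\left(\fint_Q\log(w^{-1}(y))\,dy\right)<\infty$$ (suprema over all cubes; a product $\infty\cdot0$ is understood as $\infty$). *)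

(* Defs.v *)
From HB Require Import structures.
From mathcomp Require Import all_boot all_order all_algebra.
From mathcomp Require Import all_classical all_reals all_analysis.
From mathcomp Require Import measurable_realfun ess_sup_inf.

Set Implicit Arguments.
Unset Strict Implicit.
Unset Printing Implicit Defensive.

Import Order.TTheory GRing.Theory Num.Theory.
Import numFieldNormedType.Exports.

Local Open Scope classical_set_scope.
Local Open Scope ring_scope.

Section lebesgue_cons.
Context {R : realType} {n : nat}.
Variable m : {sigma_finite_measure set (n.-tuple R) -> \bar R}.
Local Open Scope ereal_scope.

Definition tuple_cons (z : R * n.-tuple R) : n.+1.-tuple R := [tuple of z.1 :: z.2].

Lemma measurable_tuple_cons : measurable_fun [set: R * n.-tuple R] tuple_cons.
Proof.
exact: (measurable_cons (f := @fst R (n.-tuple R)) (g := @snd R (n.-tuple R))).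
Qed.

Definition lebesgue_cons : set (n.+1.-tuple R) -> \bar R :=
  pushforward (@lebesgue_measure R \x m) tuple_cons.

Let lebesgue_cons0 : lebesgue_cons set0 = 0.
Proof. by have mf := measurable_tuple_cons; exact: measure0. Qed.

Let lebesgue_cons_ge0 A : 0 <= lebesgue_cons A.
Proof. by have mf := measurable_tuple_cons; exact: measure_ge0. Qed.

Let lebesgue_cons_sigma_additive : semi_sigma_additive lebesgue_cons.
Proof.
by have mf := measurable_tuple_cons; exact: measure_semi_sigma_additive.
Qed.

HB.instance Definition _ := isMeasure.Build _ _ _ lebesgue_cons
  lebesgue_cons0 lebesgue_cons_ge0 lebesgue_cons_sigma_additive.

Definition tuple_uncons (x : n.+1.-tuple R) : R * n.-tuple R :=
  (thead x, [tuple of behead x]).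

Lemma tuple_consK : cancel tuple_cons tuple_uncons.
Proof.
by case=> a t; rewrite /tuple_uncons theadE; congr pair; exact: val_inj.
Qed.

Lemma measurable_tuple_uncons :
  measurable_fun [set: n.+1.-tuple R] tuple_uncons.
Proof.
apply: measurable_fun_pair; first exact: measurable_tnth.
exact: measurable_behead.
Qed.

Let lebesgue_cons_sigma_finite : sigma_finite setT lebesgue_cons.
Proof.
have /sigma_finiteP[F [TF ndF Foo]] := sigma_finiteT (@lebesgue_measure R).
have /sigma_finiteP[G [TG ndG Goo]] := sigma_finiteT m.
exists (fun k => tuple_uncons @^-1` (F k `*` G k)).
  apply/esym/seteqP; split=> // x _.
  have : setT (tuple_uncons x).1 by [].
  have : setT (tuple_uncons x).2 by [].
  rewrite TF TG => -[k _ Gk] [l _ Fl]; exists (maxn k l) => //; split.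
  - by move: Fl; exact/subsetPset/ndF/leq_maxr.
  - by move: Gk; exact/subsetPset/ndG/leq_maxl.
move=> k; have [mF Fk] := Foo k; have [mG Gk] := Goo k; split.
  rewrite -[X in measurable X]setTI; apply: measurable_tuple_uncons => //.
  exact: measurableX.
rewrite /lebesgue_cons /pushforward -comp_preimage (_ : _ \o _ = id).
  by rewrite preimage_id product_measure1E// lte_mul_pinfty// ge0_fin_numE.
by apply/funext => z; exact: tuple_consK.
Qed.

HB.instance Definition _ := Measure_isSigmaFinite.Build _ _ _
  lebesgue_cons lebesgue_cons_sigma_finite.

End lebesgue_cons.

(* n-fold product of the Lebesgue measure of R, on the Borel sets of R^n *)
Fixpoint borel_lebesgue {R : realType} (n : nat) :
    {sigma_finite_measure set (n.-tuple R) -> \bar R} :=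
  match n with
  | 0 => \d_([tuple] : 0.-tuple R)
  | k.+1 => lebesgue_cons (borel_lebesgue k)
  end.

(* R^n with the sigma-algebra of Lebesgue (not only Borel) measurable sets *)
Definition Rn (R : realType) (n : nat) :=
  caratheodory_type (mu_ext (@borel_lebesgue R n)).

Definition lebesgue {R : realType} {n : nat} : set (Rn R n) -> \bar R :=
  @completed_measure_extension _ _ _ (@borel_lebesgue R n).
HB.instance Definition _ (R : realType) (n : nat) :=
  Measure.on (@lebesgue R n).

Section lebesgue_boxes.
Context {R : realType}.
Local Open Scope ereal_scope.

Lemma measurable_box n (A : 'I_n -> set R) : (forall i, measurable (A i)) ->
  measurable [set x : n.-tuple R | forall i, A i (tnth x i)].
Proof.
move=> mA; rewrite (_ : [set x | _] =
    \bigcap_(i in [set` enum 'I_n]) ((fun x : n.-tuple R => tnth x i) @^-1` A i)).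
  apply: fin_bigcap_measurable => [|i _]; first exact: finite_finset.
  by rewrite -[X in measurable X]setTI; exact: measurable_tnth.
apply/seteqP; split=> x /= xA i; first by move=> _; exact: xA.
by apply: xA; rewrite /= mem_enum.
Qed.

Lemma borel_lebesgue_box n (A : 'I_n -> set R) :
  (forall i, measurable (A i)) ->
  borel_lebesgue n [set x | forall i, A i (tnth x i)] =
  \prod_(i < n) lebesgue_measure (A i).
Proof.
elim: n A => [|n IH] A mA.
  by rewrite big_ord0 /= diracE mem_set//= => -[].
rewrite big_ord_recl -IH => [|i]; last exact: mA.
rewrite -(product_measure1E lebesgue_measure (borel_lebesgue n) (mA ord0)
  (measurable_box (fun i => mA (lift ord0 i)))).
rewrite /= /lebesgue_cons /pushforward.
congr (product_measure1 _ _ _); apply/seteqP; split=> -[a t] /= h.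
  split; first by have := h ord0; rewrite tnth0.
  by move=> i; have := h (lift ord0 i); rewrite tnthS.
have [h0 ht] := h.
by move=> i; have [j ->|->] := unliftP ord0 i; rewrite ?tnthS ?tnth0.
Qed.

Lemma lebesgue_box n (A : 'I_n -> set R) : (forall i, measurable (A i)) ->
  lebesgue ([set x | forall i, A i (tnth x i)] : set (Rn R n)) =
  \prod_(i < n) lebesgue_measure (A i).
Proof.
move=> mA; rewrite -borel_lebesgue_box//.
by apply: measurable_mu_extE; exact: measurable_box.
Qed.

End lebesgue_boxes.

Section variable_exponent_weights.
Context {R : realType} {n : nat}.
Implicit Types (x y : Rn R n) (Q : set (Rn R n)) (p v w f : Rn R n -> R).

Definition norm2 x : R := Num.sqrt (\sum_(i < n) tnth x i ^+ 2).
Definition dist2 x y : R := Num.sqrt (\sum_(i < n) (tnth x i - tnth y i) ^+ 2).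

Definition exponent (q : Rn R n -> \bar R) : Prop :=
  measurable_fun setT q /\ forall x, (1 <= q x)%E.

Definition p_minus p : \bar R := ess_inf lebesgue (EFin \o p).
Definition p_plus p : \bar R := ess_sup lebesgue (EFin \o p).

(* For x = y the right-hand side of the first bound is 0, as ln 0 = 0 and
   0^-1 = 0, in agreement with the limit of - C0 / log t as t tends to 0. *)
Definition LH_with (r : Rn R n -> R) (C0 rinf Cinf : R) : Prop :=
  [/\ measurable_fun setT r,
     [/\ 0 < C0, 0 < rinf & 0 < Cinf],
     forall x y, dist2 x y < 2^-1 -> `|r x - r y| <= - (C0 / ln (dist2 x y))
   & forall x, `|r x - rinf| <= Cinf / ln (expR 1 + norm2 x)].

Definition LH (r : Rn R n -> R) : Prop :=
  exists C0 rinf Cinf : R, LH_with r C0 rinf Cinf.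

(* Exponents in LH are real-valued, so no convention for t ^ oo is needed. *)
Definition Lp_norm p f : \bar R :=
  ereal_inf [set l%:E | l in [set l : R | 0 < l /\
    (\int[lebesgue]_x (`|f x / l| `^ p x)%:E <= 1)%E]].

(* Each edge is any of [a, a+l], [a, a+l[, ]a, a+l], ]a, a+l[: the booleans
   b i and c i choose whether its endpoints are included. *)
Definition is_cube Q : Prop :=
  exists (a : n.-tuple R) (l : R) (b c : 'I_n -> bool), 0 < l /\
    Q = [set x | forall i, tnth x i \in
           Interval (BSide (b i) (tnth a i)) (BSide (c i) (tnth a i + l))].

Definition Q0 : set (Rn R n) :=
  [set x | forall i, tnth x i \in `[- expR 1, expR 1]].

Definition average Q (g : Rn R n -> \bar R) : \bar R :=
  ((\int[lebesgue]_(x in Q) g x) / lebesgue Q)%E.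

(* The product of [0, +oo] with +oo * 0 = +oo, whereas +oo * 0 = 0 for the
   library's product. *)
Definition mule_oo (a b : \bar R) : \bar R :=
  if (a == +oo%E) && (b == 0%E) || (a == 0%E) && (b == +oo%E) then +oo%E
  else (a * b)%E.

Definition weight v : Prop :=
  [/\ measurable_fun setT v, forall x, 0 <= v x & \forall x \ae lebesgue, 0 < v x].

(* If v is integrable over Q, the positive part of log v is too, and the
   average below is well defined in ]-oo, +oo]. Otherwise average Q v is +oo,
   and the product in Ainfty_const is +oo whatever the value of this factor;
   likewise for Apinfty_const when the norm of w 1_Q is infinite. *)
Definition exp_avg_log_inv v Q : \bar R :=
  expeR (average Q (fun x => (ln (v x)^-1)%:E)).

Definition Ainfty_const v : \bar R :=
  ereal_sup [set mule_oo (average Q (EFin \o v)) (exp_avg_log_inv v Q)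
            | Q in is_cube].

Definition Ainfty v : Prop := weight v /\ (Ainfty_const v < +oo)%E.

Definition Apinfty_const p w : \bar R :=
  ereal_sup [set mule_oo ((Lp_norm p \1_Q)^-1 * Lp_norm p (fun x => w x * \1_Q x)%R)%E
                         (exp_avg_log_inv w Q)
            | Q in is_cube].

Definition Apinfty p w : Prop := weight w /\ (Apinfty_const p w < +oo)%E.

Definition Ltilde p v : \bar R :=
  let vQ0 := (\int[lebesgue]_(x in Q0) (v x)%:E)%E in
  let pm := fine (p_minus p) in
  let pp := fine (p_plus p) in
  maxe (vQ0 `^ (pm^-1 - pp^-1)%R)%E (vQ0 `^ (pp^-1 - pm^-1)%R)%E.

End variable_exponent_weights.

(* Main.v *)
Require Import Defs.
From mathcomp Require Import all_boot all_order all_algebra.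
From mathcomp Require Import all_classical all_reals all_analysis.
From mathcomp Require Import measurable_realfun ess_sup_inf.
From mathcomp Require Import ring lra.

Set Implicit Arguments.
Unset Strict Implicit.
Unset Printing Implicit Defensive.

Import Order.TTheory GRing.Theory Num.Theory.
Import numFieldNormedType.Exports.

Local Open Scope classical_set_scope.
Local Open Scope ring_scope.

(** The proof takes logarithms everywhere.  Let [mu] be the Lebesgue measure,
    [h] the logarithm of the [A_infty] constant of [W], [w] the mass of [W] over
    a cube [Q], [v] the volume of [Q], [w0] the mass over [Q0], and [s] the mean
    of [1 / p] over [Q].

    The logarithmic factor of the weight [W ^ (1 / p)] is elementary: since
    [0 <= 1 / p <= 1], the [A_infty] condition on [W] bounds it by
    [exp (1 + h) * (w / v) ^ (- s)] on every cube ([exp_avg_log_inv_powR]).  So the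
    claim reduces to bounding the norm of [W ^ (1 / p)] over [Q] by about [w ^ s],
    and that of the indicator of [Q] below by about [v ^ s]
    ([quotient_bound]).

    The constants must be polynomial in the constant of [W].  This comes from
    the doubling inequality [ln_mass_double], obtained by bounding the integral of
    [ln W] with Jensen's inequality on a cube and with a tangent line of the
    logarithm on the rest of a doubled cube ([log_doubling]): the logarithm [d]
    of the doubling constant is affine in [h].  Iterating it, the
    masses of two cubes differ at most by a power of their relative size and
    position, with an exponent proportional to [d].  The log-Hoelder conditions
    bound the oscillation of the exponent by a constant over the logarithm of the
    same size and position, so what is lost is at most a multiple of [d], hence
    affine in [h].

    On a small cube ([small_cube_bound]) the exponent is nearly constant and the
    two norms are compared directly with [w ^ s] and [v ^ s].  Passing from [w]
    to [w0] is what the doubling estimate pays for, and the remaining powers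
    of [w0] are those of [Ltilde].

    On a large cube ([large_cube_bound]) the exponent is not nearly constant, but
    it is close to its limit [pinf] away from the origin.  There
    [expR_exponent_swap] replaces [p] by [pinf] in the integrals defining the
    norms, at the price of an error that decays like a power of the size of
    the point; doubling makes that power integrable against [W]
    ([polynomial_tail]).  Finally [s] is close to [1 / pinf], because only a small
    part of a large cube can be close to the origin ([avg_pV_limit]). *)

(** * Elementary inequalities *)

Lemma ln_le_tangent (R : realType) (t y : R) : 0 < t -> 0 < y ->
  ln y <= y / t + (ln t - 1).
Proof.
move=> t0 y0; have := expR_ge1Dx (ln (y / t)).
by rewrite lnK ?posrE ?divr_gt0// ln_div ?posrE//; lra.
Qed.

Lemma ln2_ge_half (R : realType) : 2^-1 <= ln (2 : R).
Proof.
have h0 : (0 : R) < 2^-1 by rewrite invr_gt0.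
by have := ln_le_tangent ltr01 h0; rewrite lnV ?posrE// ln1; lra.
Qed.

Lemma ln_ge1 (R : realType) (y : R) : expR 1 <= y -> 1 <= ln y.
Proof.
move=> ye; have e0 : (0 : R) < expR 1 := expR_gt0 _.
by rewrite -[leLHS](@expRK R) ler_ln ?posrE// (lt_le_trans e0).
Qed.

Lemma expR1_ge1 (R : realType) : (1 : R) <= expR 1.
Proof. by rewrite -[leLHS]expR0 ler_expR. Qed.

Lemma expR1_le4 (R : realType) : expR 1 <= (4 : R).
Proof.
have ln2 := ln2_ge_half R.
have -> : (4 : R) = expR (2 * ln 2).
  by rewrite expRM_natl lnK ?posrE//; ring.
by rewrite ler_expR; lra.
Qed.

Lemma exists_pow2_ge (R : realType) (y : R) : 1 <= y ->
  exists k : nat, y <= 2 ^+ k /\ k%:R <= 2 * ln y + 1.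
Proof.
move=> y1; have y0 : 0 < y by exact: lt_le_trans y1.
have l0 : 0 <= ln y by exact: ln_ge0.
exists (Num.truncn (2 * ln y)).+1; split; last first.
  by rewrite -natr1 lerD2r truncn_le// mulr_ge0.
have ln2 := ln2_ge_half R.
rewrite -ler_ln ?posrE ?exprn_gt0// lnXn// -[leRHS]mulr_natl.
have /ltW : 2 * ln y < (Num.truncn (2 * ln y)).+1%:R by exact: truncnS_gt.
move: (Num.truncn _).+1 => N hN.
apply: (@le_trans _ _ (N%:R * 2^-1)); first by lra.
by rewrite ler_wpM2l.
Qed.

Lemma dist_inv_le (R : realType) (a b : R) : 1 <= a -> 1 <= b ->
  `|a^-1 - b^-1| <= `|a - b|.
Proof.
move=> a1 b1; have a0 : 0 < a by exact: lt_le_trans a1.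
have b0 : 0 < b by exact: lt_le_trans b1.
have -> : a^-1 - b^-1 = (b - a) / (a * b) by field; rewrite !gt_eqF.
rewrite normrM distrC ler_piMr// gtr0_norm ?invr_gt0 ?mulr_gt0//.
rewrite invf_le1 ?mulr_gt0//.
by rewrite -[leLHS]mulr1 ler_pM.
Qed.

(** With [u] the logarithm of the size of a point, this trades the variable
    exponent [q] for its limit [q']: as long as [tau] lies between [- N u] and
    [N u], the error [tau * (q - q')] is at most [N * C], and below [- N u] the
    left-hand side is itself at most [expR (- N u)]. *)
Lemma expR_exponent_swap (R : realType) (tau N u q q' C : R) :
  0 < u -> 0 <= N -> tau <= N * u -> 1 <= q -> `|q - q'| <= C / u ->
  expR (tau * q) <= expR (N * C) * expR (tau * q') + expR (- (N * u)).
Proof.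
move=> u0 N0 tauN q1 qq.
have [h|h] := leP (- (N * u)) tau.
  rewrite -[leLHS]addr0; apply: lerD; last exact: expR_ge0.
  rewrite -expRD ler_expR -lerBlDr -mulrBr (le_trans (ler_norm _))// normrM.
  have -> : N * C = (N * u) * (C / u) by field; rewrite gt_eqF.
  by apply: ler_pM => //; rewrite ler_norml h.
rewrite -[leLHS]add0r; apply: lerD; first by rewrite mulr_ge0// expR_ge0.
rewrite ler_expR; have t0 : tau <= 0.
  by rewrite (le_trans (ltW h))// oppr_le0 mulr_ge0// ltW.
by apply: le_trans (ltW h); rewrite ler_neMr.
Qed.

(** * Integration *)

Lemma measurable_fun_bigmaxr d (T : measurableType d) (R : realType)
    (I : Type) (s : seq I) (D : set T) (f : I -> T -> R) :
  (forall i, measurable_fun D (f i)) ->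
  measurable_fun D (fun x => \big[Num.max/0]_(i <- s) `|f i x|).
Proof.
move=> mf; elim: s => [|i s IH].
  by under eq_fun do rewrite big_nil; exact: measurable_cst.
by under eq_fun do rewrite big_cons; apply: measurable_maxr => //; exact: measurableT_comp.
Qed.

Lemma measurable_fun_powR d (T : measurableType d) (R : realType) (f g : T -> R) :
  measurable_fun setT f -> measurable_fun setT g -> (forall x, g x != 0) ->
  measurable_fun setT (fun x => f x `^ g x).
Proof.
move=> mf mg g0.
have mZ : measurable (f @^-1` [set 0]) by rewrite -[X in measurable X]setTI; exact: mf.
rewrite (_ : (fun x => _) =
  (fun x => expR (g x * ln (f x)) * \1_(~` (f @^-1` [set 0])) x)).
  apply: measurable_funM; last by apply: measurable_indic; exact: measurableC.
  apply: measurableT_comp => //; apply: measurable_funM => //.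
  exact: measurableT_comp.
apply/funext => x; rewrite /powR indicE.
have [fx0|fx0] := eqVneq (f x) 0.
  by rewrite (negbTE (g0 x)) memNset ?mulr0//= => /(_ fx0).
by rewrite mem_set ?mulr1//=; exact/eqP.
Qed.

Lemma fine_measure_le d (T : measurableType d) (R : realType)
    (mu : {measure set T -> \bar R}) (A B : set T) (m : R) :
  measurable A -> measurable B -> A `<=` B -> mu B = m%:E -> fine (mu A) <= m.
Proof.
move=> mA mB AB muB; have AleB : (mu A <= mu B)%E by apply: le_measure; rewrite ?inE.
have Afin : mu A \is a fin_num.
  by rewrite ge0_fin_numE// (le_lt_trans AleB)// muB ltry.
by rewrite -[m]/(fine m%:E) fine_le// -muB.
Qed.

Section log_averages.
Context d (T : measurableType d) (R : realType) (mu : {measure set T -> \bar R}).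
Implicit Types (D : set T) (f g W P : T -> R).

Lemma ae_le_Rintegral D f g : measurable D ->
  mu.-integrable D (EFin \o f) -> mu.-integrable D (EFin \o g) ->
  (\forall x \ae mu, D x -> f x <= g x) ->
  \int[mu]_(x in D) f x <= \int[mu]_(x in D) g x.
Proof.
move=> mD fi gi fg; rewrite -subr_ge0 -RintegralB//.
have mgf : measurable_fun D (fun x => g x - f x).
  by apply: measurable_funB; apply/measurable_EFinP; exact: (measurable_int mu).
rewrite /Rintegral (@ae_eq_integral _ _ _ _ _ (fun x => (Num.max (g x - f x) 0)%:E))//.
- apply: fine_ge0; apply: integral_ge0 => x _.
  by rewrite lee_fin le_max lexx orbT.
- exact/measurable_EFinP.
- by apply/measurable_EFinP; apply: measurable_maxr.
- apply: filterS fg => x fg Dx; congr EFin.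
  by apply/esym/max_idPl; rewrite subr_ge0 fg.
Qed.

Section finite_measure_set.
Variables (D : set T) (m : R).
Hypotheses (mD : measurable D) (muD : mu D = m%:E).

Lemma integrable_cst_fin k : mu.-integrable D (EFin \o cst k).
Proof.
apply/integrableP; split; first by apply/measurable_EFinP; exact: measurable_cst.
by rewrite /= integral_cst// muD -EFinM ltry.
Qed.

Lemma Rintegral_cst_fin k : \int[mu]_(x in D) k = k * m.
Proof. by rewrite Rintegral_cst// muD. Qed.

Lemma Rintegral_bounds P a b : mu.-integrable D (EFin \o P) ->
  (\forall x \ae mu, D x -> a <= P x <= b) ->
  a * m <= \int[mu]_(x in D) P x <= b * m.
Proof.
move=> iP aPb; rewrite -!Rintegral_cst_fin; apply/andP; split.
- apply: ae_le_Rintegral => //; first exact: integrable_cst_fin.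
  by apply: filterS aPb => x + Dx => /(_ Dx)/andP[].
- apply: ae_le_Rintegral => //; first exact: integrable_cst_fin.
  by apply: filterS aPb => x + Dx => /(_ Dx)/andP[].
Qed.

Section affine.
Variables f g : T -> R.
Hypotheses (fi : mu.-integrable D (EFin \o f)) (gi : mu.-integrable D (EFin \o g)).

Lemma integrable_affine a b k :
  mu.-integrable D (EFin \o (fun x => a * f x + b * g x + k)).
Proof.
apply: (@eq_integrable _ _ _ _ _ mD
  (fun x => (a%:E * (f x)%:E + b%:E * (g x)%:E + k%:E)%E)).
  by move=> x _ /=.
apply: integrableD => //; last exact: integrable_cst_fin.
by apply: integrableD => //; exact: integrableZl.
Qed.

Lemma Rintegral_affine a b k : \int[mu]_(x in D) (a * f x + b * g x + k) =
  a * (\int[mu]_(x in D) f x) + b * (\int[mu]_(x in D) g x) + k * m.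
Proof.
have af : mu.-integrable D (EFin \o (fun x => a * f x)).
  exact: (integrableZl mD a fi).
have bg : mu.-integrable D (EFin \o (fun x => b * g x)).
  exact: (integrableZl mD b gi).
rewrite RintegralD//; last exact: integrable_cst_fin.
  by rewrite RintegralD// !RintegralZl// Rintegral_cst_fin.
exact: (@integrableD _ _ _ _ _ mD _ _ af bg).
Qed.

End affine.
End finite_measure_set.

Section log_average.
Variables (D : set T) (m : R) (W : T -> R).
Hypotheses (mD : measurable D) (muD : mu D = m%:E).
Hypotheses (W_gt0 : \forall x \ae mu, 0 < W x)
  (Wi : mu.-integrable D (EFin \o W))
  (lnWi : mu.-integrable D (EFin \o (fun x => ln (W x)))).

Lemma Rintegral_ln_le t : 0 < t ->
  \int[mu]_(x in D) ln (W x) <= (\int[mu]_(x in D) W x) / t + (ln t - 1) * m.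
Proof.
move=> t0.
apply: (@le_trans _ _ (\int[mu]_(x in D) (t^-1 * W x + 0 * W x + (ln t - 1)))).
  apply: ae_le_Rintegral => //; first exact: (integrable_affine mD muD).
  apply: filterS W_gt0 => x Wx Dx.
  by rewrite mul0r addr0 mulrC ln_le_tangent.
by rewrite (Rintegral_affine mD muD)// mul0r addr0 mulrC.
Qed.

Lemma jensen_ln : 0 < m -> 0 < \int[mu]_(x in D) W x ->
  \int[mu]_(x in D) ln (W x) <= m * ln ((\int[mu]_(x in D) W x) / m).
Proof.
move=> m0 w0; have := Rintegral_ln_le (divr_gt0 w0 m0).
by rewrite invf_div mulrCA divff ?gt_eqF// mulrBl; lra.
Qed.

(** Pointwise, [P ln (W / t)] is compared with [ln (W / t)]: where the logarithm is
    negative, a factor [P <= 1] brings it closer to zero, and where it is positive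
    it is dominated by [W / t]. *)
Lemma Rintegral_mul_ln_ge P t : 0 < t -> measurable_fun D P ->
  (forall x, 0 <= P x <= 1) ->
  - (\int[mu]_(x in D) (P x * ln (W x))) + ln t * \int[mu]_(x in D) P x <=
  (\int[mu]_(x in D) W x) / t - \int[mu]_(x in D) ln (W x) + ln t * m.
Proof.
move=> t0 mP P01.
have Pi : mu.-integrable D (EFin \o P).
  apply: (le_integrable mD _ _ (integrable_cst_fin mD muD 1)) => [|x _ /=].
    exact/measurable_EFinP.
  by case/andP : (P01 x) => P0 P1; rewrite normr1 ger0_norm.
have PlnWi : mu.-integrable D (EFin \o (fun x => P x * ln (W x))).
  apply: (le_integrable mD _ _ lnWi) => [|x _ /=].
    apply/measurable_EFinP; apply: measurable_funM => //.
    exact/measurable_EFinP/(measurable_int mu).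
  case/andP : (P01 x) => P0 P1.
  by rewrite lee_fin normrM ger0_norm// ler_piMl.
rewrite -mulN1r mulrC -[in leLHS](addr0 (_ + _)) -[X in _ + X](mul0r m).
rewrite mulrC -(Rintegral_affine mD muD)//.
rewrite -[X in _ - X]mul1r -mulNr [X in X + _ + _]mulrC.
rewrite -(Rintegral_affine mD muD)//.
apply: ae_le_Rintegral => //; [exact: (integrable_affine mD muD)..|].
apply: filterS W_gt0 => x Wx Dx.
have := ln_le_tangent t0 Wx; rewrite [t^-1 * _]mulrC.
have : 0 < W x / t by exact: divr_gt0.
move: (W x / t) (ln t) (ln (W x)) (P x) (P01 x) => u a b c /andP[c0 c1] u0 h.
have [ab|/ltW ab] := leP a b.
  have : 0 <= c * (b - a) by rewrite mulr_ge0// subr_ge0.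
  by lra.
have : 0 <= (1 - c) * (a - b) by rewrite mulr_ge0// subr_ge0.
by lra.
Qed.

End log_average.

(** The [A_infty] condition on [E], in logarithmic form, gives a lower bound of the
    mass of any subset [D] of positive measure: Jensen's inequality bounds the
    integral of [ln W] over [D] by means of the mass of [D], and the tangent line of
    the logarithm at the average of [W] over [E] bounds it over the rest of [E]. *)
Lemma log_doubling (D E : set T) (m M h : R) W :
  measurable D -> measurable E -> D `<=` E ->
  mu D = m%:E -> mu E = M%:E -> 0 < m ->
  (\forall x \ae mu, 0 < W x) ->
  mu.-integrable E (EFin \o W) ->
  mu.-integrable E (EFin \o (fun x => ln (W x))) ->
  0 < \int[mu]_(x in D) W x -> 0 < \int[mu]_(x in E) W x ->
  ln ((\int[mu]_(x in E) W x) / M) - (\int[mu]_(x in E) ln (W x)) / M <= h ->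
  ln ((\int[mu]_(x in E) W x) / M) <=
    ln ((\int[mu]_(x in D) W x) / m) + M / m * h + 1.
Proof.
move=> mD mE DE muD muE m0 W0 Wi lnWi wD wE hE.
have mED : measurable (E `\` D) by exact: measurableD.
have mM : m <= M by rewrite -lee_fin -muD -muE le_measure ?inE.
have M0 : 0 < M by exact: lt_le_trans mM.
have muED : mu (E `\` D) = (M - m)%:E.
  by rewrite measureD//= ?muE ?ltry// (setIidr DE) muD.
have sub : forall f, mu.-integrable E (EFin \o f) ->
    mu.-integrable D (EFin \o f) /\ mu.-integrable (E `\` D) (EFin \o f).
  by move=> f fi; split; apply: integrableS fi => //; exact: subDsetl.
have split_int f : mu.-integrable E (EFin \o f) ->
    \int[mu]_(x in E) f x =
    \int[mu]_(x in D) f x + \int[mu]_(x in E `\` D) f x.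
  move=> fi; rewrite -{1}(setDUK DE) Rintegral_setU//.
    by rewrite setDUK.
  by apply/disj_setPS => x [Dx [_ /(_ Dx)]].
have [WD WED] := sub _ Wi; have [lnD lnED] := sub _ lnWi.
have t0 : 0 < (\int[mu]_(x in E) W x) / M by exact: divr_gt0.
have := Rintegral_ln_le mED muED W0 WED lnED t0.
have := jensen_ln mD muD W0 WD lnD m0 wD.
have := split_int _ Wi; have := split_int _ lnWi.
have : (\int[mu]_(x in E) W x) / M * M = \int[mu]_(x in E) W x.
  by rewrite divfK ?gt_eqF.
move: hE t0; set t := _ / M; set qE := \int[mu]_(x in E) ln (W x).
set wE' := \int[mu]_(x in E) W x; set wED := \int[mu]_(x in E `\` D) W x.
set qD := \int[mu]_(x in D) ln (W x); set wD' := \int[mu]_(x in D) W x.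
set qED := \int[mu]_(x in E `\` D) ln (W x).
move=> hE t0 tM eq ew j1 j2.
have wEDt : wED / t <= M by rewrite ler_pdivrMr// mulrC tM ew lerDr ltW.
have qM : (ln t - h) * M <= qE by rewrite -ler_pdivlMr//; lra.
rewrite -(ler_pM2l m0) !mulrDr mulr1 mulrA mulrCA divff ?gt_eqF// mulr1.
nra.
Qed.

End log_averages.

Section integrability.
Context d (T : measurableType d) (R : realType) (mu : {measure set T -> \bar R}).

Lemma integrable_of_neg_lty (D : set T) (f : T -> \bar R) :
  measurable D -> measurable_fun D f ->
  (\int[mu]_(x in D) f^\- x < +oo -> \int[mu]_(x in D) f x < +oo ->
  mu.-integrable D f)%E.
Proof.
move=> mD mf fn fi; apply/integrableP; split=> //.
rewrite (_ : (fun x => `|f x|)%E = (f^\+ \+ f^\-)%E); last first.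
  by apply/funext => x; rewrite -/((abse \o f) x) fune_abse.
rewrite ge0_integralD//; [|exact: measurable_funepos|exact: measurable_funeneg].
rewrite lte_add_pinfty//; move: fi; rewrite integralE.
have : (\int[mu]_(x in D) f^\- x)%E \is a fin_num.
  by rewrite ge0_fin_numE// integral_ge0.
by move=> /fineK <-; case: (\int[mu]_(x in D) f^\+ x)%E => // r _; rewrite ltry.
Qed.

(** The positive part of [ln W] is at most [W], so finiteness is at stake only for
    the negative part. *)
Lemma integrable_ln (D : set T) (W : T -> R) :
  measurable D -> measurable_fun D W -> (forall x, 0 <= W x) ->
  mu.-integrable D (EFin \o W) ->
  (\int[mu]_(x in D) (- ln (W x))%:E < +oo)%E ->
  mu.-integrable D (fun x => (ln (W x))%:E).
Proof.
move=> mD mW W0 Wi fi.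
have mln : measurable_fun D (fun x => - ln (W x)).
  by apply: measurableT_comp => //; exact: measurableT_comp.
have mlnE : measurable_fun D (fun x => (- ln (W x))%:E) by exact/measurable_EFinP.
have : mu.-integrable D (fun x => (- ln (W x))%:E).
  apply: integrable_of_neg_lty => //.
  apply: (@le_lt_trans _ _ (\int[mu]_(x in D) (W x)%:E)%E); last first.
    by move/integrableP : Wi => [_]; under eq_integral do rewrite /= ger0_norm//.
  apply: ge0_le_integral => //.
  - exact: measurable_funeneg.
  - exact/measurable_EFinP.
  - move=> x _; rewrite funenegE /= opprK -EFin_max lee_fin ge_max W0 andbT.
    have := W0 x; rewrite le_eqVlt => /predU1P[<-|Wx]; first by rewrite ln0.
    exact/ltW/ln_sublinear.
move=> /integrableN; apply: eq_integrable => // x _ /=.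
by rewrite opprK.
Qed.

Lemma ge0_subset_Rintegral (A B : set T) (f : T -> R) :
  measurable A -> measurable B -> (forall x, 0 <= f x) ->
  mu.-integrable B (EFin \o f) -> A `<=` B ->
  \int[mu]_(x in A) f x <= \int[mu]_(x in B) f x.
Proof.
move=> mA mB f0 fi AB; rewrite fine_le//.
- by apply: integrable_fin_num => //; exact: integrableS fi.
- exact: integrable_fin_num.
- apply: ge0_subset_integral => // [|x _]; last by rewrite lee_fin.
  exact: measurable_int fi.
Qed.

End integrability.

Lemma ae_ge0_le_integral_lincomb d (T : measurableType d) (R : realType)
    (mu : {measure set T -> \bar R}) (D : set T) (k f g : T -> R) (a b : R) :
  measurable D -> measurable_fun D k -> measurable_fun D f -> measurable_fun D g ->
  (forall x, 0 <= k x) -> (forall x, 0 <= f x) -> (forall x, 0 <= g x) ->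
  0 <= a -> 0 <= b ->
  (\forall x \ae mu, D x -> k x <= a * f x + b * g x) ->
  (\int[mu]_(x in D) (k x)%:E <=
   a%:E * \int[mu]_(x in D) (f x)%:E + b%:E * \int[mu]_(x in D) (g x)%:E)%E.
Proof.
move=> mD mk mf mg k0 f0 g0 a0 b0 kfg.
have af0 x : (0 <= a%:E * (f x)%:E)%E by rewrite -EFinM lee_fin mulr_ge0.
have bg0 x : (0 <= b%:E * (g x)%:E)%E by rewrite -EFinM lee_fin mulr_ge0.
have maf : measurable_fun D (fun x => a%:E * (f x)%:E)%E.
  by apply: measurable_funeM; exact/measurable_EFinP.
have mbg : measurable_fun D (fun x => b%:E * (g x)%:E)%E.
  by apply: measurable_funeM; exact/measurable_EFinP.
rewrite -!ge0_integralZl//; try exact/measurable_EFinP; last 2 first.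
- by move=> x _; rewrite lee_fin.
- by move=> x _; rewrite lee_fin.
rewrite -ge0_integralD//.
apply: ae_ge0_le_integral => //.
- by move=> x _; rewrite lee_fin.
- exact/measurable_EFinP.
- by move=> x _; exact: adde_ge0.
- exact: emeasurable_funD.
Qed.

(** On the shell between [E j] and [E j.+1] the decay [r ^+ j.+1] of [g] beats the
    growth [D ^+ j.+1] of the integral of [f] by a factor [2 ^ (- j.+1)], and the
    contributions of the shells form a geometric series. *)
Lemma dyadic_tail_integral d (T : measurableType d) (R : realType)
    (mu : {measure set T -> \bar R}) (E : nat -> set T) (f g : T -> R)
    (F0 D r : R) :
  (forall j, measurable (E j)) -> (forall j, E j `<=` E j.+1) ->
  measurable_fun setT f -> measurable_fun setT g ->
  (forall x, 0 <= f x) -> (forall x, 0 <= g x) ->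
  0 <= F0 -> 0 <= D -> 0 <= r -> r * D <= 2^-1 ->
  (forall j, (\int[mu]_(x in E j) (f x)%:E <= (D ^+ j * F0)%:E)%E) ->
  (forall x, E 0%N x -> g x <= 1) ->
  (forall j x, ~ E j x -> g x <= r ^+ j.+1) ->
  forall J, (\int[mu]_(x in E J) (f x * g x)%:E <= ((2 - 2^-1 ^+ J) * F0)%:E)%E.
Proof.
move=> mE sE mf mg f0 g0 F00 D0 r0 rD Ef g1 gr.
have mfg A : measurable_fun A (fun x => (f x * g x)%:E).
  by apply/measurable_EFinP/measurable_funTS; exact: measurable_funM.
have mfE A : measurable_fun A (fun x => (f x)%:E).
  by apply/measurable_EFinP; exact: measurable_funTS.
elim=> [|J IH].
  apply: (@le_trans _ _ (\int[mu]_(x in E 0%N) (f x)%:E)%E); last first.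
    by rewrite (le_trans (Ef 0%N))// lee_fin !expr0 mul1r; lra.
  apply: ge0_le_integral => // x Ex; first by rewrite lee_fin mulr_ge0.
  by rewrite lee_fin ler_piMr// g1.
rewrite -(setDUK (sE J)) ge0_integral_setU//; last 3 first.
- exact: measurableD.
- by move=> x _; rewrite lee_fin mulr_ge0.
- by apply/disj_setPS => x [Ex [_ /(_ Ex)]].
have -> : (2 - 2^-1 ^+ J.+1) * F0 = (2 - 2^-1 ^+ J) * F0 + 2^-1 ^+ J.+1 * F0.
  by rewrite exprS; field.
rewrite EFinD; apply: leeD => //.
apply: (@le_trans _ _ (\int[mu]_(x in E J.+1) ((r ^+ J.+1)%:E * (f x)%:E))%E).
  apply: (@le_trans _ _
      (\int[mu]_(x in E J.+1 `\` E J) ((r ^+ J.+1)%:E * (f x)%:E))%E).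
    apply: ge0_le_integral => //.
    - exact: measurableD.
    - by move=> x _; rewrite lee_fin mulr_ge0.
    - exact: measurable_funeM.
    - move=> x [_ Ex]; rewrite -EFinM lee_fin mulrC ler_wpM2r//; exact: gr.
  apply: ge0_subset_integral => //; first exact: measurableD.
  - exact: measurable_funeM.
  - by move=> x _; rewrite -EFinM lee_fin mulr_ge0// exprn_ge0.
rewrite ge0_integralZl//; last 2 first.
- by move=> x _; rewrite lee_fin.
- by rewrite lee_fin exprn_ge0.
apply: (@le_trans _ _ ((r ^+ J.+1)%:E * (D ^+ J.+1 * F0)%:E)%E).
  by rewrite lee_wpmul2l// lee_fin exprn_ge0.
rewrite -EFinM lee_fin mulrA -exprMn ler_wpM2r// lerXn2r// nnegrE// mulr_ge0//.
Qed.

Section modulars.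
Context d (T : measurableType d) (R : realType) (mu : {measure set T -> \bar R}).
Variables (D : set T) (p : T -> R).
Hypotheses (mD : measurable D) (mp : measurable_fun D p).

Let measurable_expRp b : measurable_fun D (fun x => expR (- b * p x)).
Proof. by apply: measurableT_comp => //; exact: measurable_funM. Qed.

(** Pointwise almost everywhere the integrand is at most [W] divided by its integral. *)
Lemma modular_le1 (W : T -> R) b : (forall x, 0 <= W x) ->
  mu.-integrable D (EFin \o W) -> 0 < \int[mu]_(x in D) W x ->
  (\forall x \ae mu, D x -> ln (\int[mu]_(x in D) W x) <= b * p x) ->
  (\int[mu]_(x in D) (W x * expR (- b * p x))%:E <= 1)%E.
Proof.
move=> W0 Wi; set w := \int[mu]_(x in D) W x => w0 hb.
have mW : measurable_fun D W by exact/measurable_EFinP/(measurable_int mu).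
apply: (@le_trans _ _ (\int[mu]_(x in D) ((w^-1)%:E * (W x)%:E))%E).
  apply: ae_ge0_le_integral => //.
  - by move=> x _; rewrite lee_fin mulr_ge0// expR_ge0.
  - by apply/measurable_EFinP; exact: measurable_funM.
  - by move=> x _; rewrite -EFinM lee_fin mulr_ge0// invr_ge0 ltW.
  - by apply: measurable_funeM; exact/measurable_EFinP.
  - apply: filterS hb => x hx Dx; rewrite -EFinM lee_fin mulrC ler_wpM2r//.
    by rewrite -[X in _ <= X^-1](lnK w0) -expRN ler_expR mulNr lerN2 hx.
rewrite integralZl//.
have -> : (\int[mu]_(x in D) (W x)%:E = w%:E)%E.
  by rewrite /w /Rintegral fineK//; exact: integrable_fin_num.
by rewrite -EFinM mulVf// gt_eqF.
Qed.

(** If [b' < b], the integrand is at least [expR (b - b') / m], whose integral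
    exceeds [1]. *)
Lemma modular_indic_le1 (m b b' : R) : mu D = m%:E -> 0 < m ->
  (forall x, 1 <= p x) -> (forall x, D x -> b * p x <= ln m) ->
  (\int[mu]_(x in D) (expR (- b' * p x))%:E <= 1)%E -> b <= b'.
Proof.
move=> muD m0 p1 hb; apply: contraTT; rewrite -!ltNge => bb'.
apply: (@lt_le_trans _ _ (\int[mu]_(x in D) (expR (b - b') / m)%:E)%E).
  rewrite integral_cst//= muD -EFinM divfK ?gt_eqF// lte_fin.
  by rewrite -[ltLHS]expR0 ltr_expR subr_gt0.
apply: ge0_le_integral => //.
- by move=> x _; rewrite lee_fin divr_ge0 ?expR_ge0// ltW.
- exact/measurable_EFinP.
move=> x Dx; rewrite lee_fin -[X in _ / X](lnK m0) -expRN -expRD ler_expR.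
have := hb x Dx; have : 0 <= (b - b') * (p x - 1).
  by rewrite mulr_ge0 ?subr_ge0// ltW.
lra.
Qed.

End modulars.

(** * Cubes and balls of the sup norm *)

Section geometry.
Context {R : realType} {n : nat}.
Implicit Types (x y c : Rn R n) (Q : set (Rn R n)).

(** The sup norm is used instead of the Euclidean one because its balls are the
    cubes; up to constants it gives the same log-Hoelder condition at infinity. *)
Definition supnorm x : R := \big[Num.max/0]_(i < n) `|tnth x i|.

Definition cball c (r : R) : set (Rn R n) :=
  [set x | forall i, tnth x i \in `[tnth c i - r, tnth c i + r]].

Definition origin : Rn R n := [tuple 0 | _ < n].

Lemma cballE c r x : cball c r x <-> forall i, `|tnth x i - tnth c i| <= r.
Proof. by split=> h i; move: (h i); rewrite in_itv/= ler_distl. Qed.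

Lemma supnorm_ge0 x : 0 <= supnorm x.
Proof. exact: bigmax_ge_id. Qed.

Lemma supnorm_leP x r : 0 <= r ->
  reflect (forall i, `|tnth x i| <= r) (supnorm x <= r).
Proof.
move=> r0; apply: (iffP idP) => [/bigmax_leP[_ h] i|h]; first exact: h.
by apply/bigmax_leP; split.
Qed.

Lemma coord_le_supnorm x i : `|tnth x i| <= supnorm x.
Proof. exact: le_bigmax. Qed.

Lemma cball_origin r : 0 <= r -> cball origin r = [set x | supnorm x <= r].
Proof.
move=> r0; apply/seteqP; split=> x.
  move=> /cballE h; apply/(supnorm_leP _ r0) => i.
  by have := h i; rewrite tnth_mktuple subr0.
move=> /(supnorm_leP _ r0) h; apply/cballE => i.
by rewrite tnth_mktuple subr0.
Qed.

Lemma supnorm_cball c r x : 0 <= r ->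
  cball c r x -> supnorm x <= supnorm c + r.
Proof.
move=> r0 /cballE h; apply/supnorm_leP => [|i].
  by rewrite addr_ge0// supnorm_ge0.
rewrite -[tnth x i](subrK (tnth c i)) (le_trans (ler_normD _ _))// addrC.
by rewrite lerD// coord_le_supnorm.
Qed.

Lemma cball_sym c r x : cball c r x -> cball x r c.
Proof. by move=> /cballE h; apply/cballE => i; rewrite distrC. Qed.

Lemma subset_cball c r c' r' :
  (forall i, `|tnth c i - tnth c' i| + r <= r') -> cball c r `<=` cball c' r'.
Proof.
move=> h x /cballE xc; apply/cballE => i; apply: le_trans (h i).
rewrite -[tnth x i](subrK (tnth c i)) -addrA (le_trans (ler_normD _ _))//.
by rewrite [leRHS]addrC lerD2r.
Qed.

Lemma subset_cball_center c r r' : r <= r' -> cball c r `<=` cball c r'.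
Proof. by move=> h; apply: subset_cball => i; rewrite subrr normr0 add0r. Qed.

Lemma supnorm_le_norm2 x : supnorm x <= norm2 x.
Proof.
apply/supnorm_leP => [|i]; first exact: sqrtr_ge0.
rewrite -sqrtr_sqr ler_sqrt ?sumr_ge0// => [|j _]; last exact: sqr_ge0.
by rewrite (bigD1 i)//= lerDl sumr_ge0// => j _; exact: sqr_ge0.
Qed.

Lemma dist2_le x y r : 0 <= r -> (forall i, `|tnth x i - tnth y i| <= r) ->
  dist2 x y <= n%:R * r.
Proof.
move=> r0 h; rewrite -(@ger0_norm _ (n%:R * r)) ?mulr_ge0//.
rewrite -sqrtr_sqr ler_sqrt ?sqr_ge0//.
apply: (@le_trans _ _ (\sum_(i < n) r ^+ 2)).
  apply: ler_sum => i _; rewrite -real_normK ?num_real//.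
  by rewrite ler_pXn2r// nnegrE.
rewrite sumr_const card_ord -[leLHS]mulr_natl exprMn ler_wpM2r ?sqr_ge0//.
by rewrite -natrX ler_nat -mulnn; have [->//|n0] := posnP n; rewrite leq_pmulr.
Qed.

Lemma measurable_tnth_Rn i :
  measurable_fun [set: Rn R n] (fun x : Rn R n => tnth x i).
Proof.
move=> _ A mA; rewrite setTI; apply: sub_caratheodory.
by apply: sub_sigma_algebra; rewrite -[X in measurable X]setTI; exact: measurable_tnth.
Qed.

Lemma measurable_Rbox (A : 'I_n -> set R) : (forall i, measurable (A i)) ->
  measurable ([set x | forall i, A i (tnth x i)] : set (Rn R n)).
Proof.
by move=> mA; apply: sub_caratheodory; apply: sub_sigma_algebra; exact: measurable_box.
Qed.

Lemma measurable_supnorm : measurable_fun [set: Rn R n] supnorm.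
Proof.
exact: (@measurable_fun_bigmaxr _ (Rn R n) R _ _ _
  (fun i (x : Rn R n) => tnth x i) measurable_tnth_Rn).
Qed.

(** Whichever faces it contains, a cube enters all the estimates only through its
    volume and its inclusion in the closed ball with the same center. *)
Lemma is_cube_data Q : is_cube Q -> exists c l, [/\ 0 < l,
  Q `<=` cball c (l / 2), measurable Q & lebesgue Q = (l ^+ n)%:E].
Proof.
move=> [a [l [b [d [l0 ->]]]]].
pose c : Rn R n := [tuple tnth a i + l / 2 | i < n].
exists c, l; split=> //.
- move=> x h i; have := h i; rewrite /c tnth_mktuple.
  rewrite !in_itv/=.
  case: (b i) (d i) => -[] /=; lra.
- by apply: (measurable_Rbox (A := fun i => [set` _])) => i; exact: measurable_itv.
- rewrite (lebesgue_box (A := fun i => [set` _])); last first.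
    by move=> i; exact: measurable_itv.
  under eq_bigr => i _.
    rewrite lebesgue_measure_itv/= lte_fin ltrDl l0 -EFinB.
    rewrite (_ : _ - _ = l); last by ring.
    over.
  by rewrite prodEFin prodr_const card_ord.
Qed.

Lemma is_cube_cball c r : 0 < r -> is_cube (cball c r).
Proof.
move=> r0; exists [tuple tnth c i - r | i < n], (2 * r), xpredT, xpred0.
split; first by rewrite mulr_gt0.
apply/seteqP; split=> x h i; have := h i; rewrite tnth_mktuple !in_itv/=; lra.
Qed.

Lemma lebesgue_cball c r : 0 < r -> lebesgue (cball c r) = ((2 * r) ^+ n)%:E.
Proof.
move=> r0.
rewrite (lebesgue_box (A := fun i => [set` _])); last first.
  by move=> i; exact: measurable_itv.
under eq_bigr => i _.
  rewrite lebesgue_measure_itv/= lte_fin (_ : _ < _); last by lra.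
  rewrite -EFinB (_ : _ - _ = 2 * r); last by ring.
  over.
by rewrite prodEFin prodr_const card_ord.
Qed.

Lemma Q0E : Q0 = cball origin (expR 1).
Proof.
by apply/seteqP; split=> x h i; have := h i; rewrite /= tnth_mktuple sub0r add0r.
Qed.

Lemma measurable_cball c r : measurable (cball c r).
Proof.
by apply: (measurable_Rbox (A := fun i => [set` _])) => i; exact: measurable_itv.
Qed.

End geometry.

(** * The A_infty condition and doubling *)

Section A_infty_cubes.
Context {R : realType} {n : nat}.
Implicit Types (c : Rn R n) (Q : set (Rn R n)) (W : Rn R n -> R).
Local Notation mu := (@lebesgue R n).

(** The convention [+oo * 0 = +oo] in the constant is what forces the average of
    [W] to be finite, and then finiteness of the second factor makes [ln W]
    integrable. *)
Lemma cube_A_infty W H Q (m : R) : weight W -> Ainfty_const W = H%:E ->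
  is_cube Q -> measurable Q -> mu Q = m%:E -> 0 < m ->
  0 < H /\
  [/\ mu.-integrable Q (EFin \o W),
      mu.-integrable Q (EFin \o (fun x => ln (W x))),
      0 < \int[mu]_(x in Q) W x &
      ln ((\int[mu]_(x in Q) W x) / m) - (\int[mu]_(x in Q) ln (W x)) / m <= ln H].
Proof.
move=> [mW W0 Wae] WH cQ mQ muQ m0.
have : (mule_oo (average Q (EFin \o W)) (exp_avg_log_inv W Q) <= H%:E)%E.
  by rewrite -WH; apply: ereal_sup_ubound; exists Q.
rewrite /exp_avg_log_inv /average muQ inver gt_eqF//.
have mWQ : measurable_fun Q W by exact: measurable_funTS.
have mlnW : measurable_fun Q (fun x => ln (W x)).
  exact: measurableT_comp.
set I := (\int[mu]_(x in Q) (EFin \o W) x)%E.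
set J := (\int[mu]_(x in Q) (ln (W x)^-1)%:E)%E.
have I0 : (0 <= I)%E by apply: integral_ge0 => x _; rewrite lee_fin.
have Ilty : (mule_oo (I * m^-1%:E) (expeR (J * m^-1%:E)) <= H%:E)%E -> (I < +oo)%E.
  rewrite ltey; apply: contraTneq => ->.
  rewrite gt0_mulye ?lte_fin ?invr_gt0// /mule_oo eqxx/=.
  case: eqP => [_|/eqP h]; first by rewrite -ltNge ltry.
  by rewrite gt0_mulye ?lt0e ?h ?expeR_ge0// -ltNge ltry.
move=> HQ; have {}Ilty := Ilty HQ.
have Wi : mu.-integrable Q (EFin \o W).
  apply/integrableP; split; first exact/measurable_EFinP.
  by under eq_integral do rewrite /= ger0_norm//.
have wI : (\int[mu]_(x in Q) W x)%:E = I.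
  by rewrite /Rintegral fineK// ge0_fin_numE.
have w0 : 0 < \int[mu]_(x in Q) W x.
  rewrite lt_neqAle Rintegral_ge0// andbT eq_sym; apply/eqP => w0.
  have : (\int[mu]_(x in Q) `|(EFin \o W) x| = 0)%E.
    under eq_integral do rewrite /= ger0_norm//.
    by rewrite -/I -wI w0.
  move/(ae_eq_integral_abs mu mQ); move=> /(_ _)/wrap[]//.
    exact/measurable_EFinP.
  move=> W00.
  have : \forall x \ae mu, ~ Q x.
    by apply: filterS2 Wae W00 => x Wx + Qx => /(_ Qx)[] Wx0; rewrite Wx0 ltxx in Wx.
  case=> N [mN N0 QN].
  have : (mu Q <= mu N)%E.
    by apply: le_measure; rewrite ?inE// => x Qx; apply: QN => /(_ Qx).
  by rewrite muQ N0 lee_fin leNgt m0.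
have Jlty : (J < +oo)%E.
  rewrite ltey; apply/eqP => Jy; move: HQ.
  rewrite Jy gt0_mulye ?lte_fin ?invr_gt0//= /mule_oo eqxx andbT.
  have a0 : (0 < I * m^-1%:E)%E by rewrite -wI -EFinM lte_fin divr_gt0.
  by rewrite (gt_eqF a0) andbF/= gt0_muley// leNgt ltry.
have lnVE x : ln (W x)^-1 = - ln (W x).
  have := W0 x; rewrite le_eqVlt => /predU1P[<-|Wx]; last by rewrite lnV.
  by rewrite invr0 ln0// oppr0.
have JE : J = (\int[mu]_(x in Q) (- ln (W x))%:E)%E.
  by apply: eq_integral => x _; rewrite lnVE.
have lni : mu.-integrable Q (EFin \o (fun x => ln (W x))).
  by apply: integrable_ln => //; rewrite -JE.
have JEr : J = (- \int[mu]_(x in Q) ln (W x))%:E.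
  rewrite JE EFinN /Rintegral fineK; last exact: integrable_fin_num.
  rewrite -integralN//; last exact: integrable_add_def.
move: HQ; rewrite -wI JEr -!EFinM /= /mule_oo !andbF/=.
rewrite -EFinM lee_fin => HQ.
have H0 : 0 < H by apply: lt_le_trans HQ; rewrite mulr_gt0 ?expR_gt0// divr_gt0.
split=> //; split=> //.
rewrite -ler_ln ?posrE// in HQ; last by rewrite mulr_gt0 ?expR_gt0// divr_gt0.
by move: HQ; rewrite lnM ?posrE ?expR_gt0 ?divr_gt0// expRK mulNr.
Qed.

(** The [A_infty] condition, with [h] the logarithm of the constant. *)
Definition log_A_infty W (h : R) : Prop :=
  forall Q m, is_cube Q -> measurable Q -> mu Q = m%:E -> 0 < m ->
  [/\ mu.-integrable Q (EFin \o W),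
      mu.-integrable Q (EFin \o (fun x => ln (W x))),
      0 < \int[mu]_(x in Q) W x &
      ln ((\int[mu]_(x in Q) W x) / m) - (\int[mu]_(x in Q) ln (W x)) / m <= h].

Lemma Ainfty_log W : Ainfty W ->
  exists H, [/\ Ainfty_const W = H%:E, 0 < H & log_A_infty W (ln H)].
Proof.
move=> [wW]; case WH : (Ainfty_const W) => [H| |]// _; last first.
  exfalso; have r1 : (0 : R) < 1 by [].
  suff : (0 <= Ainfty_const W)%E by rewrite WH.
  apply: ereal_sup_ge; eexists; first by exists (cball origin 1); [exact: is_cube_cball|].
  have [mW W0 _] := wW.
  have a0 : (0 <= average (cball origin 1) (EFin \o W))%E.
    rewrite /average lebesgue_cball// mule_ge0//.
      by apply: integral_ge0 => x _; rewrite lee_fin.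
    by rewrite inve_ge0 lee_fin exprn_ge0// mulr_ge0.
  rewrite /mule_oo; case: ifP => // _; exact/mule_ge0/expeR_ge0.
exists H; split=> // [|Q m cQ mQ muQ m0].
  have r1 : (0 : R) < 1 by [].
  have m0 : 0 < (2 * 1) ^+ n :> R by rewrite exprn_gt0// mulr_gt0.
  by have [] := cube_A_infty wW WH (is_cube_cball origin r1)
    (measurable_cball _ _) (lebesgue_cball origin r1) m0.
by have [] := cube_A_infty wW WH cQ mQ muQ m0.
Qed.

Lemma log_A_infty_ge0 W h : weight W -> log_A_infty W h -> 0 <= h.
Proof.
move=> [_ _ Wae] Wh; have r1 : (0 : R) < 1 by [].
have m0 : 0 < (2 * 1) ^+ n :> R by rewrite exprn_gt0// mulr_gt0.
have mQ := @measurable_cball R n origin 1.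
have [Wi lnWi w0 hW] := Wh _ _ (is_cube_cball origin r1) mQ
  (lebesgue_cball origin r1) m0.
apply: le_trans hW; rewrite subr_ge0 ler_pdivrMr// mulrC.
exact: (jensen_ln mQ (lebesgue_cball origin r1)).
Qed.

End A_infty_cubes.

Section mass_growth.
Context {R : realType} {n : nat}.
Local Notation mu := (@lebesgue R n).
Variables (W : Rn R n -> R) (h : R).
Hypotheses (wW : weight W) (Wh : log_A_infty W h).

Definition mass (Q : set (Rn R n)) : R := \int[mu]_(x in Q) W x.

(** Logarithm of the doubling constant of [W].  It is affine in [h], which is why all
    final constants are powers of the [A_infty] constant. *)
Definition doubling_exp : R := 1 + n%:R * ln 2 + 2 ^+ n * h.

Lemma doubling_exp_ge1 : 1 <= doubling_exp.
Proof.
rewrite /doubling_exp -addrA lerDl addr_ge0// mulr_ge0 ?exprn_ge0//.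
  by rewrite ln_ge0// ler1n.
exact: log_A_infty_ge0 Wh.
Qed.

Lemma mass_gt0 Q m : is_cube Q -> measurable Q -> mu Q = m%:E -> 0 < m ->
  0 < mass Q.
Proof. by move=> cQ mQ muQ m0; have [] := Wh cQ mQ muQ m0. Qed.

Lemma mass_cball_gt0 c r : 0 < r -> 0 < mass (cball c r).
Proof.
move=> r0; apply: (mass_gt0 (is_cube_cball c r0) (measurable_cball c r)
  (lebesgue_cball c r0)).
by rewrite exprn_gt0// mulr_gt0.
Qed.

Lemma mass_le (A B : set (Rn R n)) : measurable A -> measurable B ->
  mu.-integrable B (EFin \o W) -> A `<=` B -> mass A <= mass B.
Proof.
have [mW W0 _] := wW.
by move=> mA mB Wi; exact: ge0_subset_Rintegral.
Qed.

Lemma ln_mass_double Q E m : is_cube Q -> measurable Q -> mu Q = m%:E -> 0 < m ->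
  is_cube E -> measurable E -> mu E = (2 ^+ n * m)%:E -> Q `<=` E ->
  ln (mass E) <= ln (mass Q) + doubling_exp.
Proof.
move=> cQ mQ muQ m0 cE mE muE QE.
have M0 : 0 < 2 ^+ n * m by rewrite mulr_gt0// exprn_gt0.
have [_ _ Wae] := wW.
have [_ _ wQ _] := Wh cQ mQ muQ m0.
have [Wi lnWi wE hE] := Wh cE mE muE M0.
have := log_doubling mQ mE QE muQ muE m0 Wae Wi lnWi wQ wE hE.
rewrite -/(mass Q) -/(mass E) !ln_div ?posrE// lnM ?posrE ?exprn_gt0//.
by rewrite lnXn// mulfK ?gt_eqF// /doubling_exp -mulr_natl; lra.
Qed.

Lemma ln_mass_cball_pow c r k : 0 < r ->
  ln (mass (cball c (2 ^+ k * r))) <= ln (mass (cball c r)) + k%:R * doubling_exp.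
Proof.
move=> r0; elim: k => [|k IH]; first by rewrite expr0 mul1r mul0r addr0.
have r'0 : 0 < 2 ^+ k * r by rewrite mulr_gt0// exprn_gt0.
have r''0 : 0 < 2 ^+ k.+1 * r by rewrite mulr_gt0// exprn_gt0.
have -> : k.+1%:R * doubling_exp = k%:R * doubling_exp + doubling_exp.
  by rewrite -natr1 mulrDl mul1r.
rewrite addrA; apply: le_trans (lerD IH (lexx _)).
apply: (ln_mass_double (is_cube_cball c r'0) (measurable_cball _ _)
  (lebesgue_cball c r'0) _ (is_cube_cball c r''0) (measurable_cball _ _)).
- by rewrite exprn_gt0// mulr_gt0.
- by rewrite lebesgue_cball// -exprMn exprS -mulrA.
- by apply: subset_cball_center; rewrite ler_pM2r// ler_weXn2l// ler1n.
Qed.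

(** Iterating the doubling inequality about [ln y] times: mass grows at most
    polynomially, with an exponent proportional to [doubling_exp]. *)
Lemma ln_mass_growth c l Q E y : 0 < l -> is_cube Q -> measurable Q ->
  mu Q = (l ^+ n)%:E -> Q `<=` cball c (l / 2) ->
  measurable E -> 0 < mass E -> 1 <= y -> E `<=` cball c (y * l) ->
  ln (mass E) <= ln (mass Q) + (2 * ln y + 2) * doubling_exp.
Proof.
move=> l0 cQ mQ muQ Qc mE wE y1 Ec.
have [k [yk kle]] := exists_pow2_ge y1.
have kl0 : 0 < 2 ^+ k * l by rewrite mulr_gt0// exprn_gt0.
have lk : 0 < (2 * (2 ^+ k * l)) ^+ n by rewrite exprn_gt0// mulr_gt0.
have [Wi _ wk _] := Wh (is_cube_cball c kl0) (measurable_cball _ _)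
  (lebesgue_cball c kl0) lk.
apply: (@le_trans _ _ (ln (mass (cball c (2 ^+ k * l))))).
  rewrite ler_ln ?posrE//; apply: mass_le => //; first exact: measurable_cball.
  by apply: subset_trans Ec _; apply: subset_cball_center; rewrite ler_pM2r.
have := ln_mass_cball_pow c k l0.
have : ln (mass (cball c l)) <= ln (mass Q) + doubling_exp.
  apply: (ln_mass_double cQ mQ muQ _ (is_cube_cball c l0) (measurable_cball _ _)).
  - by rewrite exprn_gt0.
  - by rewrite lebesgue_cball// exprMn.
  - by apply: subset_trans Qc _; apply: subset_cball_center; lra.
have d1 := doubling_exp_ge1.
have : k%:R * doubling_exp <= (2 * ln y + 1) * doubling_exp.
  by rewrite ler_wpM2r// (le_trans ler01).
lra.
Qed.

Lemma Q0_cube : is_cube (Q0 : set (Rn R n)).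
Proof. by rewrite Q0E; apply: is_cube_cball; rewrite expR_gt0. Qed.

Lemma mass_Q0_gt0 : 0 < mass Q0.
Proof. by rewrite Q0E; apply: mass_cball_gt0; rewrite expR_gt0. Qed.

End mass_growth.

Section comparison_with_Q0.
Context {R : realType} {n : nat}.
Local Notation mu := (@lebesgue R n).
Variables (W : Rn R n -> R) (h : R).
Hypotheses (wW : weight W) (Wh : log_A_infty W h).
Variables (Q : set (Rn R n)) (c : Rn R n) (l : R).
Hypotheses (cQ : is_cube Q) (mQ : measurable Q) (l0 : 0 < l)
  (muQ : mu Q = (l ^+ n)%:E) (Qc : Q `<=` cball c (l / 2)).

Lemma growth_factor_le (y : R) : expR 1 <= y ->
  (2 * ln y + 2) * doubling_exp (n := n) h <= 4 * doubling_exp (n := n) h * ln y.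
Proof.
move=> ye; have d1 := doubling_exp_ge1 wW Wh.
have l1 := ln_ge1 ye.
have : 0 <= doubling_exp (n := n) h * (ln y - 1).
  by rewrite mulr_ge0 ?subr_ge0// (le_trans ler01).
lra.
Qed.

Lemma ln_mass_Q0_le y : expR 1 <= y -> supnorm c + expR 1 <= y * l ->
  ln (mass W Q0) <= ln (mass W Q) + 4 * doubling_exp (n := n) h * ln y.
Proof.
move=> ye cy; apply: le_trans; last first.
  by apply: lerD (lexx _) _; exact: growth_factor_le.
apply: (ln_mass_growth wW Wh l0 cQ mQ muQ Qc).
- by rewrite Q0E; exact: measurable_cball.
- exact: mass_Q0_gt0 Wh.
- by rewrite (le_trans _ ye)// -[leLHS]expR0 ler_expR.
- rewrite Q0E; apply: subset_cball => i; rewrite tnth_mktuple sub0r normrN.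
  by apply: le_trans cy; rewrite lerD2r coord_le_supnorm.
Qed.

Lemma ln_mass_le_Q0 y : expR 1 <= y -> supnorm c + l / 2 <= 2 * expR 1 * y ->
  ln (mass W Q) <= ln (mass W Q0) + 4 * doubling_exp (n := n) h * ln y.
Proof.
move=> ye cy; apply: le_trans; last first.
  by apply: lerD (lexx _) _; exact: growth_factor_le.
have e0 : (0 : R) < expR 1 := expR_gt0 _.
apply: (@ln_mass_growth _ _ _ _ wW Wh origin (2 * expR 1)) => //.
- exact: Q0_cube.
- by rewrite Q0E; exact: measurable_cball.
- by rewrite Q0E lebesgue_cball.
- rewrite Q0E; apply: subset_cball_center.
  by rewrite mulrC mulKf.
- by apply: (mass_gt0 Wh cQ mQ muQ); rewrite exprn_gt0.
- by rewrite (le_trans _ ye)// -[leLHS]expR0 ler_expR.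
- apply: subset_trans Qc _; apply: subset_cball => i.
  rewrite tnth_mktuple subr0 [leRHS]mulrC; apply: le_trans cy.
  by rewrite lerD2r coord_le_supnorm.
Qed.

End comparison_with_Q0.

(** * Log-Hoelder exponents *)

Section exponents.
Context {R : realType} {n : nat}.
Local Notation mu := (@lebesgue R n).
Variables (p : Rn R n -> R) (C0 pinf Cinf : R).
Hypotheses (p_exp : exponent (fun x => (p x)%:E)) (pLH : LH_with p C0 pinf Cinf).

(** Logarithm of the size of a point, at least [1] everywhere. *)
Definition lnsize (x : Rn R n) : R := ln (expR 1 + supnorm x).

Lemma size_ge_e (x : Rn R n) : expR 1 <= expR 1 + supnorm x.
Proof. by rewrite lerDl supnorm_ge0. Qed.

Lemma lnsize_ge1 x : 1 <= lnsize x.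
Proof. exact/ln_ge1/size_ge_e. Qed.

Lemma p_ge1 x : 1 <= p x.
Proof. by have [_ /(_ x)] := p_exp; rewrite lee_fin. Qed.

Lemma measurable_p : measurable_fun [set: Rn R n] p.
Proof. by have [] := pLH. Qed.

Lemma measurable_pV : measurable_fun [set: Rn R n] (fun x => (p x)^-1).
Proof.
rewrite (_ : (fun x => (p x)^-1) = (@powR R ^~ (-1)) \o p).
  by apply: measurableT_comp measurable_p; exact: measurable_powR.
apply/funext => x /=; rewrite powR_inv1//.
by rewrite (le_trans ler01)// p_ge1.
Qed.

Lemma pV_itv x : 0 <= (p x)^-1 <= 1.
Proof.
have p1 := p_ge1 x; have p0 : 0 < p x by exact: lt_le_trans p1.
by rewrite invr_ge0 ltW//= invf_le1.
Qed.

Lemma p_at_infinity x : `|p x - pinf| <= Cinf / lnsize x.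
Proof.
have [_ [_ _ Cinf0] _ /(_ x) h] := pLH; apply: le_trans h _.
have e0 : (0 : R) < expR 1 := expR_gt0 _.
rewrite ler_pM2l// lef_pV2 ?posrE; last 2 first.
- by apply: (@lt_le_trans _ _ 1) => //; apply: ln_ge1; rewrite lerDl sqrtr_ge0.
- exact: lt_le_trans (lnsize_ge1 x).
rewrite ler_ln ?posrE ?ltr_pwDl ?supnorm_ge0 ?sqrtr_ge0//.
by rewrite lerD2l supnorm_le_norm2.
Qed.

(** The limit exponent is approached along the points far from the origin, which
    exist in positive dimension. *)
Lemma pinf_ge1 : (0 < n)%N -> 1 <= pinf.
Proof.
move=> n0; rewrite leNgt; apply/negP => pinf1.
have [_ [_ _ Cinf0] _ _] := pLH.
(* at a point [x] with [lnsize x >= t], the exponent would be less than 1 *)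
pose t := Cinf / (1 - pinf) + 1.
have t0 : 0 < t by rewrite addr_gt0// divr_gt0// subr_gt0.
pose x : Rn R n := [tuple expR t | _ < n].
have tx : t <= lnsize x.
  rewrite /lnsize -[leLHS](@expRK R) ler_ln ?posrE ?expR_gt0//; last first.
    by rewrite ltr_pwDl ?expR_gt0 ?supnorm_ge0.
  apply: (@le_trans _ _ (supnorm x)); last by rewrite lerDr expR_ge0.
  have := coord_le_supnorm x (Ordinal n0).
  by rewrite tnth_mktuple ger0_norm ?expR_ge0.
have := p_at_infinity x; apply/negP; rewrite -ltNge.
apply: (@lt_le_trans _ _ (1 - pinf)); last first.
  by rewrite (le_trans _ (ler_norm _))// lerD2r p_ge1.
rewrite ltr_pdivrMr; last exact: lt_le_trans (lnsize_ge1 x).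
apply: (@lt_le_trans _ _ ((1 - pinf) * t)); last by rewrite ler_pM2l// subr_gt0.
by rewrite mulrDr mulrCA divff ?gt_eqF ?subr_gt0// !mulr1 ltrDl subr_gt0.
Qed.

(** The local condition bounds the oscillation by the inverse of [ln (1 / l)], the
    condition at infinity bounds it by the inverse of the logarithm of the position
    of the cube.  So it beats the logarithm of any quantity that is polynomial in
    both. *)
Lemma small_cube_oscillation c l x y : (0 < n)%N -> 0 < l ->
  4 * n%:R ^+ 2 * l <= 1 -> cball c (l / 2) x -> cball c (l / 2) y ->
  `|(p x)^-1 - (p y)^-1| * ln ((expR 1 + supnorm c + 1) * (2 / l)) <=
  4 * (C0 + Cinf).
Proof.
move=> n0 l0 ln1 cx cy.
have [_ [C00 _ Cinf0] ploc _] := pLH.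
have e0 : (0 : R) < expR 1 := expR_gt0 _.
have n1 : (1 : R) <= n%:R by rewrite ler1n.
have nn0 : (0 : R) < n%:R by rewrite ltr0n.
have e1 := expR1_ge1 R.
have c0 := supnorm_ge0 c.
have l14 : l <= 4^-1.
  have : 1 * l <= n%:R ^+ 2 * l by rewrite ler_pM2r// exprn_ege1.
  by move: ln1; rewrite -mulrA; lra.
have lnl : ln 2 <= - ln l.
  by rewrite -lnV ?posrE// ler_ln ?posrE ?invr_gt0// -div1r ler_pdivlMr//; lra.
have ln20 : 0 < ln (2 : R) by rewrite ln_gt0// ltr1n.
have nl1 : n%:R * l <= 4^-1.
  have : n%:R * l <= n%:R ^+ 2 * l by rewrite ler_pM2r// expr2 ler_peMl// ltW.
  by move: ln1; rewrite -mulrA; lra.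
have nl0 : 0 < n%:R * l by rewrite mulr_gt0.
(* smallness of [l] gives [(n * l) ^ 2 <= l], so replacing [l] by the Euclidean
   diameter [n * l] costs a factor 2 in the logarithm *)
have lnnl : - ln l <= 2 * - ln (n%:R * l).
  rewrite mulrN lerN2 [leLHS]mulr_natl -lnXn// ler_ln ?posrE ?exprn_gt0//.
  rewrite exprMn [X in _ * X]expr2 mulrA -[leRHS]mul1r ler_pM2r//.
  have : 0 <= n%:R ^+ 2 * l by rewrite mulr_ge0 ?exprn_ge0// ltW.
  by move: ln1; rewrite -mulrA; lra.
have h1 : `|p x - p y| * - ln l <= 2 * C0.
  have dxy : dist2 x y <= n%:R * l.
    apply: dist2_le => [|i]; first exact: ltW.
    move/cballE : cx => /(_ i); move/cballE : cy => /(_ i).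
    rewrite !ler_distl; move: (tnth x i) (tnth y i) (tnth c i) => a b d; lra.
  have := ploc x y; move: dxy; have : 0 <= dist2 x y by exact: sqrtr_ge0.
  move: (dist2 x y) => v v0 vnl.
  have v2 : v < 2^-1 by apply: le_lt_trans vnl _; lra.
  move=> /(_ v2) pv; move: v0; rewrite le_eqVlt => /predU1P[v0|v0].
    have : `|p x - p y| <= 0 by rewrite (le_trans pv)// -v0 ln0// invr0 mulr0 oppr0.
    by rewrite normr_le0 => /eqP ->; rewrite normr0 mul0r mulr_ge0// ltW.
  have lnv : ln v <= ln (n%:R * l) by rewrite ler_ln ?posrE.
  have lnv0 : 0 < - ln v.
    have : 0 < - ln l by lra.
    by lra.
  have : `|p x - p y| * - ln v <= C0.
    by rewrite -ler_pdivlMr// invrN mulrN.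
  have : `|p x - p y| * - ln l <= `|p x - p y| * (2 * - ln v).
    by rewrite ler_wpM2l//; lra.
  lra.
have h2 z : cball c (l / 2) z ->
    `|p z - pinf| * ln (expR 1 + supnorm c + 1) <= 2 * Cinf.
  move=> cz; have u1 := lnsize_ge1 z; have u0 : 0 < lnsize z by lra.
  have hz : `|p z - pinf| * lnsize z <= Cinf.
    by rewrite -ler_pdivlMr//; exact: p_at_infinity.
  have lz : ln (expR 1 + supnorm c + 1) <= 2 * lnsize z.
    have ez := size_ge_e z.
    rewrite [leRHS]mulr_natl -lnXn; last by lra.
    rewrite ler_ln ?posrE ?exprn_gt0//; [|lra|lra].
    have l20 : 0 <= l / 2 by rewrite divr_ge0// ltW.
    have := supnorm_cball l20 (cball_sym cz).
    have e2 : 2 <= expR 1 :> R by have := expR_ge1Dx (1 : R); lra.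
    move: ez; move: (supnorm z) (supnorm_ge0 z) => sz sz0 _ csz.
    by nra.
  have : `|p z - pinf| * ln (expR 1 + supnorm c + 1) <= `|p z - pinf| * (2 * lnsize z).
    by rewrite ler_wpM2l.
  lra.
have ec0 : 0 < expR 1 + supnorm c + 1 by lra.
rewrite lnM ?posrE ?divr_gt0// ln_div ?posrE//.
set A := ln (expR 1 + supnorm c + 1).
have A0 : 0 <= A by rewrite ln_ge0//; lra.
apply: (@le_trans _ _ (`|p x - p y| * (A + 2 * - ln l))).
  apply: ler_pM => //; first by lra.
    exact/dist_inv_le/p_ge1/p_ge1.
  by lra.
rewrite mulrDr.
have : `|p x - p y| * A <= (`|p x - pinf| + `|p y - pinf|) * A.
  by rewrite ler_wpM2r// (distrC (p y)) ler_distD.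
have := h2 x cx; have := h2 y cy; rewrite -/A; lra.
Qed.

End exponents.

Lemma measurable_size_power (R : realType) (n : nat) (N : R) :
  measurable_fun [set: Rn R n] (fun x => expR (- (N * lnsize x))).
Proof.
have ms := @measurable_supnorm R n.
apply: (@measurable_comp _ _ _ _ _ _ setT (fun s => expR (- (N * ln (expR 1 + s)))))
  => //.
apply: measurableT_comp => //; apply: measurable_funN.
apply: measurable_funM => //; apply: measurableT_comp => //.
exact: measurable_funD.
Qed.

(** If the integral of [f] over a ball grows at most like the power [d / ln 2] of the
    radius, then a power of the size of [x] with a larger exponent makes [f]
    integrable, with a bound that does not depend on [A]. *)
Lemma polynomial_tail (R : realType) (n : nat) (f : Rn R n -> R)
    (F0 d N : R) (A : set (Rn R n)) J :
  measurable_fun setT f -> (forall x, 0 <= f x) -> 0 <= F0 -> 0 <= d ->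
  d + ln 2 <= N * ln 2 ->
  (forall j, (\int[lebesgue]_(x in cball origin (2 ^+ j * expR 1)) (f x)%:E <=
              (expR (j%:R * d) * F0)%:E)%E) ->
  measurable A -> A `<=` cball origin (2 ^+ J * expR 1) ->
  (\int[lebesgue]_(x in A) (f x * expR (- (N * lnsize x)))%:E <= (2 * F0)%:E)%E.
Proof.
move=> mf f0 F00 d0 dN fE mA AJ.
have e0 : (0 : R) < expR 1 := expR_gt0 _.
have e2 : 2 <= expR 1 :> R by have := expR_ge1Dx (1 : R); lra.
have l20 : 0 < ln (2 : R) by rewrite ln_gt0// ltr1n.
have N0 : 0 <= N.
  rewrite -(pmulr_lge0 _ l20); apply: le_trans dN; lra.
have mg := @measurable_size_power R n N.
have r0 j : 0 <= 2 ^+ j * expR 1 :> R by rewrite mulr_ge0 ?exprn_ge0// ltW.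
have H := @dyadic_tail_integral _ (Rn R n) R lebesgue
  (fun j => cball origin (2 ^+ j * expR 1)) f
  (fun x => expR (- (N * lnsize x))) F0 (expR d) (expR (- (N * ln 2)))
  (fun j => measurable_cball _ _).
have {H} := H _ mf mg f0 (fun x => expR_ge0 _) F00 (expR_ge0 _) (expR_ge0 _).
move=> /(_ _)/wrap[|H].
  move=> j; apply: subset_cball_center; rewrite ler_wpM2r ?expR_ge0//.
  by rewrite ler_weXn2l// ler1n.
have {H}H : forall J, (\int[lebesgue]_(x in cball origin (2 ^+ J * expR 1))
    (f x * expR (- (N * lnsize x)))%:E <= ((2 - 2^-1 ^+ J) * F0)%:E)%E.
  apply: H.
  - rewrite -expRD -[X in _ <= X^-1](@lnK R) ?posrE// -expRN ler_expR; lra.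
  - by move=> j; rewrite -expRM_natl.
  - move=> x _; rewrite -[leRHS]expR0 ler_expR oppr_le0 mulr_ge0//.
    by rewrite (le_trans ler01)// lnsize_ge1.
  - move=> j x; rewrite cball_origin//= => /negP; rewrite -ltNge => jx.
    rewrite -expRM_natl ler_expR mulrN lerN2 mulrCA ler_wpM2l//.
    rewrite [leLHS]mulr_natl -lnXn// ler_ln ?posrE ?exprn_gt0//; last first.
      by rewrite (lt_le_trans e0)// size_ge_e.
    rewrite exprSr; have : 2 ^+ j * 2 <= 2 ^+ j * expR 1 :> R.
      by rewrite ler_wpM2l// exprn_ge0.
    lra.
apply: (@le_trans _ _ (\int[lebesgue]_(x in cball origin (2 ^+ J * expR 1))
    (f x * expR (- (N * lnsize x)))%:E)%E).
  have mfg : measurable_fun (cball origin (2 ^+ J * expR 1))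
      (fun x => (f x * expR (- (N * lnsize x)))%:E).
    by apply/measurable_EFinP/measurable_funTS; exact: measurable_funM.
  have fg0 x : cball origin (2 ^+ J * expR 1) x ->
      (0 <= (f x * expR (- (N * lnsize x)))%:E)%E.
    by move=> _; rewrite lee_fin mulr_ge0// expR_ge0.
  exact: (@ge0_subset_integral _ (Rn R n) R lebesgue A _ mA
    (measurable_cball _ _) _ mfg fg0 AJ).
apply: le_trans (H J) _; rewrite lee_fin ler_wpM2r// gerBl.
by rewrite exprn_ge0.
Qed.

(** * Norms over a cube *)

Section norms.
Context {R : realType} {n : nat}.
Local Notation mu := (@lebesgue R n).
Variables (p : Rn R n -> R) (Q : set (Rn R n)).
Hypothesis p1 : forall x, 1 <= p x.

Lemma modular_powR_indic (W : Rn R n -> R) b : (forall x, 0 <= W x) ->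
  (\int[mu]_x (`|W x `^ (p x)^-1 * \1_Q x / expR b| `^ p x)%:E =
   \int[mu]_(x in Q) (W x * expR (- b * p x))%:E)%E.
Proof.
move=> W0; rewrite [RHS]integral_mkcond; apply: eq_integral => x _.
have p0 : 0 < p x by exact: lt_le_trans (p1 x).
rewrite patchE indicE; case: ifPn => xQ; last first.
  by rewrite mulr0 mul0r normr0 powR0// gt_eqF.
rewrite mulr1 ger0_norm; last by rewrite divr_ge0 ?powR_ge0 ?expR_ge0.
rewrite powRM ?powR_ge0 ?invr_ge0 ?expR_ge0// -powRrM mulVf ?gt_eqF// powRr1//.
by rewrite -expRN -expRM.
Qed.

Lemma Lp_norm_powR_le (W : Rn R n -> R) b : (forall x, 0 <= W x) ->
  (\int[mu]_(x in Q) (W x * expR (- b * p x))%:E <= 1)%E ->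
  (Lp_norm p (fun x => W x `^ (p x)^-1 * \1_Q x)%R <= (expR b)%:E)%E.
Proof.
move=> W0 h; apply: ereal_inf_lbound; exists (expR b) => //.
by split; [exact: expR_gt0|rewrite modular_powR_indic].
Qed.

Lemma Lp_norm_indic_ge b :
  (forall b', (\int[mu]_(x in Q) (expR (- b' * p x))%:E <= 1)%E -> b <= b') ->
  ((expR b)%:E <= Lp_norm p \1_Q)%E.
Proof.
move=> hb; apply: le_ereal_inf_tmp => _ [l [l0 h] <-]; rewrite lee_fin.
rewrite -(lnK l0) ler_expR; apply: hb; apply: le_trans h.
have := @modular_powR_indic (fun=> 1) (ln l) (fun=> ler01).
under [X in _ = X -> _]eq_integral do rewrite mul1r.
move=> <-; under eq_integral do rewrite powR1 mul1r lnK//.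
done.
Qed.

End norms.

Lemma average_deviation (R : realType) (I v a i C t u : R) :
  C * I <= C * (u * v) ->
  - C * I + (i - C * t) * v <= a * v -> a * v <= C * I + (i + C * t) * v ->
  ((i - (C * t + C * u)) * v <= a * v) && (a * v <= (i + (C * t + C * u)) * v).
Proof. by move=> h1 h2 h3; apply/andP; split; lra. Qed.

(** For [y >= e], replacing [y] by [(4 n ^ 2 + 1) y] multiplies [ln y] by at most
    this factor; the cubes of edge at least [1 / (4 n ^ 2)] are the large ones. *)
Definition log_dim (R : realType) (n : nat) : R := 1 + ln (4 * n%:R ^+ 2 + 1).

Section cube_bounds.
Context {R : realType} {n : nat}.
Local Notation mu := (@lebesgue R n).
Variables (p : Rn R n -> R) (C0 pinf Cinf : R).
Hypotheses (n0 : (0 < n)%N)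
  (p_exp : exponent (fun x => (p x)%:E)) (pLH : LH_with p C0 pinf Cinf).
Variables (W : Rn R n -> R) (h : R).
Hypotheses (wW : weight W) (Wh : log_A_infty W h).
Variables (Q : set (Rn R n)) (c : Rn R n) (l : R).
Hypotheses (cQ : is_cube Q) (mQ : measurable Q) (l0 : 0 < l)
  (muQ : mu Q = (l ^+ n)%:E) (Qc : Q `<=` cball c (l / 2)).

Let vol : R := l ^+ n.
Let avg_pV : R := (\int[mu]_(x in Q) (p x)^-1) / vol.
Let vol0 : 0 < vol. Proof. exact: exprn_gt0. Qed.

Let W0 : forall x, 0 <= W x. Proof. by have [] := wW. Qed.
Let mW : measurable_fun setT W. Proof. by have [] := wW. Qed.
Let Wae : \forall x \ae mu, 0 < W x. Proof. by have [] := wW. Qed.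
Let mp : measurable_fun setT p. Proof. exact: measurable_p pLH. Qed.
Let mpV := measurable_pV p_exp pLH.
Let p1 := p_ge1 p_exp.

Let mass_gt0 : 0 < mass W Q.
Proof. exact: (mass_gt0 Wh cQ mQ muQ). Qed.

Let pVi : mu.-integrable Q (EFin \o (fun x => (p x)^-1)).
Proof.
apply: (le_integrable mQ _ _ (integrable_cst_fin mQ muQ 1)) => [|x _ /=].
  by apply/measurable_EFinP; exact: measurable_funTS.
by have /andP[pV0 pV1] := pV_itv p_exp x; rewrite normr1 ger0_norm.
Qed.

Lemma avg_pV_bounds a b :
  (\forall x \ae mu, Q x -> a <= (p x)^-1 <= b) -> a <= avg_pV <= b.
Proof.
move=> /(Rintegral_bounds mQ muQ pVi).
by rewrite -ler_pdivlMr// -[X in _ && X]ler_pdivrMr.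
Qed.

(** The logarithmic factor of [W ^ (1 / p)]: since [1 / p <= 1], replacing [1 / p] by
    its mean costs at most the factor [e] times the [A_infty] constant of [W]. *)
Lemma exp_avg_log_inv_powR : exists E,
  exp_avg_log_inv (fun x => W x `^ (p x)^-1) Q = (expR E)%:E /\
  E <= 1 + h - avg_pV * ln (mass W Q / vol).
Proof.
have [Wi lnWi w0 hW] := Wh cQ mQ muQ vol0.
have t0 : 0 < mass W Q / vol by exact: divr_gt0.
exists (- (\int[mu]_(x in Q) ((p x)^-1 * ln (W x))) / vol); split; last first.
  have := Rintegral_mul_ln_ge mQ muQ Wae Wi lnWi t0 (measurable_funTS mpV)
    (pV_itv p_exp).
  rewrite -/(mass W Q) invf_div mulrCA divff ?gt_eqF// mulr1.
  rewrite -(ler_pM2r (x := vol^-1)) ?invr_gt0//.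
  rewrite !mulrDl !mulNr divff ?gt_eqF// mulfK ?gt_eqF// -mulrA.
  move: hW; rewrite -/(mass W Q) -/vol -/avg_pV; lra.
rewrite /exp_avg_log_inv /average muQ -/vol inver gt_eqF//.
have lnE x : ln (W x `^ (p x)^-1)^-1 = - ((p x)^-1 * ln (W x)).
  rewrite -ln_powR; have := powR_ge0 (W x) (p x)^-1.
  rewrite le_eqVlt => /predU1P[<-|Wx]; last by rewrite lnV.
  by rewrite invr0 ln0// oppr0.
under eq_integral do rewrite lnE.
have PlnWi : mu.-integrable Q (EFin \o (fun x => (p x)^-1 * ln (W x))).
  apply: (le_integrable mQ _ _ lnWi) => [|x _ /=].
    apply/measurable_EFinP; apply: measurable_funM; first exact: measurable_funTS.
    exact/measurable_EFinP/(measurable_int mu).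
  have /andP[pV0 pV1] := pV_itv p_exp x.
  by rewrite lee_fin normrM ger0_norm// ler_piMl.
have -> : (\int[mu]_(x in Q) (- ((p x)^-1 * ln (W x)))%:E =
    (- \int[mu]_(x in Q) ((p x)^-1 * ln (W x)))%:E)%E.
  rewrite EFinN /Rintegral fineK; last exact: integrable_fin_num.
  by rewrite -integralN//; exact: integrable_add_def.
by rewrite -EFinM.
Qed.

Lemma quotient_bound bw b1 X :
  (Lp_norm p (fun x => W x `^ (p x)^-1 * \1_Q x)%R <= (expR bw)%:E)%E ->
  ((expR b1)%:E <= Lp_norm p \1_Q)%E ->
  bw - b1 - avg_pV * ln (mass W Q / vol) <= X ->
  (mule_oo ((Lp_norm p \1_Q)^-1 *
      Lp_norm p (fun x => W x `^ (p x)^-1 * \1_Q x)%R)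
    (exp_avg_log_inv (fun x => W x `^ (p x)^-1)%R Q) <= (expR (X + 1 + h))%:E)%E.
Proof.
move=> hbw hb1 hX; have [E [-> hE]] := exp_avg_log_inv_powR.
set Nw := Lp_norm p _ in hbw *; set N1 := Lp_norm p _ in hb1 *.
have Nw0 : (0 <= Nw)%E.
  by apply: le_ereal_inf_tmp => _ [t [t0 _] <-]; rewrite lee_fin ltW.
move: Nw N1 hbw hb1 Nw0 => Nw N1 hbw hb1 Nw0.
have N10 : (0 <= N1)%E by apply: le_trans hb1; rewrite lee_fin expR_ge0.
have N1V : (N1^-1 <= (expR (- b1))%:E)%E.
  rewrite expRN -[X in (_ <= X)%E](_ : (expR b1)%:E^-1%E = _); last first.
    by rewrite inver gt_eqF// expR_gt0.
  by rewrite lee_pV2 ?inE ?lee_fin ?expR_ge0.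
have N1V0 : (0 <= N1^-1)%E by rewrite inve_ge0.
have : (N1^-1 * Nw <= (expR (bw - b1))%:E)%E.
  apply: (@le_trans _ _ ((expR (- b1))%:E * (expR bw)%:E)%E).
    exact: lee_pmul.
  by rewrite -EFinM -expRD addrC.
have : (0 <= N1^-1 * Nw)%E by exact: mule_ge0.
case: (N1^-1 * Nw)%E => // r; rewrite !lee_fin => r0 rb.
rewrite /mule_oo/= andbF -EFinM lee_fin.
apply: (@le_trans _ _ (expR (bw - b1) * expR E)).
  by rewrite ler_wpM2r// expR_ge0.
by rewrite -expRD ler_expR; lra.
Qed.

(** * Small cubes *)

Section oscillation_cost.
Variables (pm pp : R).
Hypothesis pV_ae : \forall x \ae mu, pp^-1 <= (p x)^-1 <= pm^-1.

(** Logarithm of [Ltilde], in terms of the essential bounds of the exponent. *)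
Definition Q0_cost : R := (pm^-1 - pp^-1) * `|ln (mass W Q0)|.

Lemma pV_dist_avg :
  \forall x \ae mu, ((p x)^-1 - avg_pV) * ln (mass W Q0) <= Q0_cost.
Proof.
have : pp^-1 <= avg_pV <= pm^-1.
  by apply: avg_pV_bounds; apply: filterS pV_ae => x hx _.
move=> /andP[a1 a2]; apply: filterS pV_ae => x /andP[b1 b2].
rewrite (le_trans (ler_norm _))// normrM ler_wpM2r// ler_norml.
by apply/andP; split; lra.
Qed.

Lemma weighted_norm_le bw :
  (\forall x \ae mu, Q x -> ln (mass W Q) <= bw * p x) ->
  (Lp_norm p (fun x => W x `^ (p x)^-1 * \1_Q x)%R <= (expR bw)%:E)%E.
Proof.
move=> hbw; apply: Lp_norm_powR_le => //.
have [Wi _ _ _] := Wh cQ mQ muQ vol0.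
exact: (modular_le1 mQ (measurable_funTS mp) W0 Wi mass_gt0).
Qed.

Lemma indic_norm_ge b : (forall x, Q x -> b * p x <= ln vol) ->
  ((expR b)%:E <= Lp_norm p \1_Q)%E.
Proof.
move=> hb; apply: (Lp_norm_indic_ge (Q := Q) p1) => b'.
exact: (modular_indic_le1 (p := p) mQ (measurable_funTS mp) muQ vol0 p1 hb).
Qed.

(** Both norms are compared with powers whose exponent is the mean of [1 / p].  The
    quantity [y] dominates the size and position of the cube and the inverse of its
    edge, so that [ln y] controls all masses and volumes involved while the
    oscillation of [1 / p] is at most a constant over [ln y]. *)
Lemma small_cube_bound : 4 * n%:R ^+ 2 * l <= 1 ->
  (mule_oo ((Lp_norm p \1_Q)^-1 *
      Lp_norm p (fun x => W x `^ (p x)^-1 * \1_Q x)%R)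
    (exp_avg_log_inv (fun x => W x `^ (p x)^-1)%R Q) <=
   (expR (Q0_cost + (4 * doubling_exp (n := n) h + n%:R) * (4 * (C0 + Cinf))
     + 1 + h))%:E)%E.
Proof.
move=> lsmall; set d := doubling_exp h; set K := 4 * (C0 + Cinf).
have [_ [C00 _ Cinf0] _ _] := pLH.
have d1 : 1 <= d := doubling_exp_ge1 wW Wh.
set y := (expR 1 + supnorm c + 1) * (2 / l).
have n1 : (1 : R) <= n%:R by rewrite ler1n.
have l14 : l <= 4^-1.
  have : 1 * l <= n%:R ^+ 2 * l by rewrite ler_pM2r// exprn_ege1.
  by move: lsmall; rewrite -mulrA; lra.
have c0 := supnorm_ge0 c.
have e1 := expR1_ge1 R.
have lV : 1 <= 2 / l by rewrite ler_pdivlMr//; lra.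
have cy : expR 1 + supnorm c + 1 <= y by rewrite ler_peMr//; lra.
have ye : expR 1 <= y by lra.
have lny1 : 1 <= ln y by exact: ln_ge1.
have lny0 : 0 < ln y by lra.
have yl : y * l = 2 * (expR 1 + supnorm c + 1).
  by rewrite /y -mulrA divfK ?gt_eqF// mulrC.
have hQ0 : ln (mass W Q0) <= ln (mass W Q) + 4 * d * ln y.
  by apply: (ln_mass_Q0_le wW Wh cQ mQ l0 muQ Qc ye); rewrite yl; lra.
have hQ : ln (mass W Q) <= ln (mass W Q0) + 4 * d * ln y.
  apply: (ln_mass_le_Q0 wW Wh cQ mQ l0 muQ Qc ye).
  have : 1 * y <= expR 1 * y by rewrite ler_wpM2r//; lra.
  by rewrite -mulrA; lra.
have osc x : Q x -> `|(p x)^-1 - avg_pV| * ln y <= K.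
  move=> Qx; rewrite -ler_pdivlMr// distrC ler_distl.
  apply: avg_pV_bounds; apply: aeW => z Qz.
  rewrite -ler_distl ler_pdivlMr//.
  exact: (small_cube_oscillation p_exp pLH n0 l0 lsmall (Qc Qz) (Qc Qx)).
have osc_mul x a B : Q x -> `|a| <= B * ln y -> 0 <= B ->
    ((p x)^-1 - avg_pV) * a <= B * K.
  move=> Qx aB B0; rewrite (le_trans (ler_norm _))// normrM.
  apply: (@le_trans _ _ (`|(p x)^-1 - avg_pV| * (B * ln y))).
    by rewrite ler_wpM2l.
  by rewrite mulrCA ler_wpM2l// osc.
have K0 : 0 <= K by rewrite mulr_ge0//; lra.
have mulp x (u v : R) : (p x)^-1 * u <= v -> u <= v * p x.
  by rewrite mulrC ler_pdivrMr// (lt_le_trans _ (p1 x)).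
apply: (quotient_bound (bw := avg_pV * ln (mass W Q) + Q0_cost + 4 * d * K)
  (b1 := avg_pV * ln vol - n%:R * K)).
- apply: weighted_norm_le; apply: filterS pV_dist_avg => x hx Qx.
  apply: mulp.
  have : ((p x)^-1 - avg_pV) * (ln (mass W Q) - ln (mass W Q0)) <= 4 * d * K.
    apply: osc_mul => //; last by rewrite mulr_ge0//; lra.
    by rewrite ler_norml; apply/andP; split; lra.
  lra.
- apply: indic_norm_ge => x Qx.
  have px0 : 0 < p x by exact: lt_le_trans (p1 x).
  rewrite -ler_pdivlMr// mulrC.
  have : ((p x)^-1 - avg_pV) * - ln vol <= n%:R * K.
    apply: osc_mul => //.
    have lnl : ln l <= 0 by rewrite ln_le0//; lra.
    rewrite /vol lnXn// -[X in - X]mulr_natl normrN normrM normr_nat.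
    rewrite ler_wpM2l//.
    rewrite ler0_norm// -lnV ?posrE// ler_ln ?posrE ?invr_gt0//; last first.
      by apply: lt_le_trans ye; rewrite expR_gt0.
    have lV0 : 0 < l^-1 by rewrite invr_gt0.
    rewrite /y mulrCA mulrA -[leLHS]mul1r ler_pM2r//; lra.
  lra.
- rewrite ln_div ?posrE//; lra.
Qed.

End oscillation_cost.

(** * Large cubes *)

Lemma cube_subset_dyadic : exists J, Q `<=` cball origin (2 ^+ J * expR 1).
Proof.
have c0 := supnorm_ge0 c; have l_gt0 := l0.
have y1 : 1 <= supnorm c + l + 1 by lra.
have [k [yk _]] := exists_pow2_ge y1; exists k.
apply: subset_trans Qc _; apply: subset_cball => i; rewrite tnth_mktuple subr0.
have := coord_le_supnorm c i; have : 2 ^+ k * 1 <= 2 ^+ k * expR 1 :> R.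
  by rewrite ler_wpM2l ?exprn_ge0 ?expR1_ge1.
lra.
Qed.

Let S : R := expR 1 + supnorm c + l.
Let Se : expR 1 <= S.
Proof. by rewrite /S -addrA lerDl addr_ge0 ?supnorm_ge0 ?ltW. Qed.
Let lnS1 : 1 <= ln S. Proof. exact: ln_ge1. Qed.
Let S0 : 0 < S. Proof. by apply: lt_le_trans Se; exact: expR_gt0. Qed.

(** If a cube of size [S] meets the ball of radius [sqrt S], its edge is comparable
    to [S], so the ball fills at most a fraction of order [1 / sqrt S] of it. *)
Lemma cube_near_origin :
  \int[mu]_(x in Q) \1_(cball origin (Num.sqrt S)) x <= 11 / ln S * vol.
Proof.
have e0 := expR_gt0 (1 : R); have e4 := expR1_le4 R.
have l_gt0 := l0; have lnS_ge1 := lnS1.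
set r := Num.sqrt S; have r0 : 0 < r by rewrite sqrtr_gt0.
have lnS0 : 0 < ln S by lra.
have mA := @measurable_cball R n origin r.
have -> : \int[mu]_(x in Q) \1_(cball origin r) x = fine (mu (cball origin r `&` Q)).
  by rewrite /Rintegral integral_indic.
have mAQ : measurable (cball origin r `&` Q) by exact: measurableI.
have IQ : fine (mu (cball origin r `&` Q)) <= vol.
  by apply: (fine_measure_le mAQ mQ _ muQ) => x [].
(* for [ln S <= 11] the claim is weaker than the trivial bound by the volume;
   beyond, [r > 11 / 2] is large enough for the numerical estimates below *)
have [S11|S11] := leP (ln S) 11.
  apply: (le_trans IQ); rewrite -[leLHS]mul1r ler_wpM2r//; first exact: ltW.
  by rewrite ler_pdivlMr// mul1r.
have rS : r ^+ 2 = S by rewrite sqr_sqrtr// ltW.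
have lnr : ln S = 2 * ln r by rewrite -rS lnXn// -[LHS]mulr_natl.
have lnrr : ln r < r by exact: ln_sublinear.
have [[x [xr Qx]]|Q0] := pselect (exists x, cball origin r x /\ Q x); last first.
  rewrite (_ : _ `&` _ = set0) ?measure0/=; last first.
    by apply/seteqP; split=> x // h'; apply: Q0; exists x.
  by rewrite mulr_ge0 ?divr_ge0// ltW.
have cr : supnorm c <= r + l / 2.
  have l20 : 0 <= l / 2 by rewrite divr_ge0// ltW.
  have := supnorm_cball l20 (cball_sym (Qc Qx)).
  by move: xr; rewrite (cball_origin (ltW r0))/=; lra.
have rl : 3 * r ^+ 2 <= 8 * l.
  have : r ^+ 2 <= 4 + r + 3 / 2 * l by rewrite rS /S; lra.
  by nra.
have rl' : 2 * r / l <= 11 / ln S.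
  rewrite ler_pdivrMr// mulrAC ler_pdivlMr//.
  have : ln S <= 2 * r by rewrite lnr; lra.
  by nra.
have rl1 : 2 * r / l <= 1.
  rewrite ler_pdivrMr// mul1r; nra.
apply: (@le_trans _ _ ((2 * r) ^+ n)).
  by apply: (fine_measure_le mAQ mA _ (lebesgue_cball origin r0)) => z [].
rewrite -ler_pdivrMr// -expr_div_n; apply: le_trans rl'.
case: (n) n0 => // k _; rewrite exprS ler_piMr ?exprn_ile1//.
  by rewrite divr_ge0// ?mulr_ge0// ltW.
by rewrite divr_ge0// ?mulr_ge0// ltW.
Qed.

Let pinf1 : 1 <= pinf. Proof. exact: pinf_ge1 p_exp pLH n0. Qed.

(** Outside the ball of radius [sqrt S] the exponent is within [2 Cinf / ln S] of its
    limit, and [cube_near_origin] handles the ball. *)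
Lemma avg_pV_limit : `|avg_pV - pinf^-1| <= 13 * Cinf / ln S.
Proof.
have [_ [_ _ Cinf0] _ _] := pLH.
have e0 := expR_gt0 (1 : R); have lnS_ge1 := lnS1.
have lnS0 : 0 < ln S by lra.
pose A := cball origin (Num.sqrt S) : set (Rn R n).
have mA : measurable A by exact: measurable_cball.
have ptw x : `|(p x)^-1 - pinf^-1| <= Cinf * (2 / ln S + \1_A x).
  have u1 := lnsize_ge1 x; have u0 : 0 < lnsize x by lra.
  apply: (le_trans (dist_inv_le (p1 x) pinf1)).
  apply: (le_trans (p_at_infinity pLH x)); rewrite ler_pM2l//.
  rewrite indicE; case: (boolP (x \in A)) => [_|/negP xA].
    have : 0 <= 2 / ln S by rewrite divr_ge0// ltW.
    have : (lnsize x)^-1 <= 1 by rewrite invf_le1.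
    by rewrite mulr1n; lra.
  rewrite mulr0n addr0 -[leLHS]mul1r ler_pdivrMr// mulrAC ler_pdivlMr// mul1r.
  rewrite [leRHS]mulr_natl -lnXn; last first.
    by apply: (lt_le_trans e0); exact: size_ge_e.
  rewrite ler_ln ?posrE// ?exprn_gt0//; last first.
    by apply: (lt_le_trans e0); exact: size_ge_e.
  rewrite -[leLHS]sqr_sqrtr; last exact: ltW.
  rewrite ler_pXn2r ?nnegrE ?sqrtr_ge0//; last first.
    by rewrite addr_ge0 ?expR_ge0 ?supnorm_ge0.
  have : ~ supnorm x <= Num.sqrt S.
    by move=> xS; apply: xA; rewrite inE /A cball_origin ?sqrtr_ge0.
  by move=> /negP; rewrite -ltNge => /ltW; have := e0; lra.
have iA : mu.-integrable Q (EFin \o \1_A).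
  apply: (le_integrable mQ _ _ (integrable_cst_fin mQ muQ 1)) => [|x _ /=].
    by apply/measurable_EFinP; exact: measurable_indic.
  rewrite indicE lee_fin normr1; case: (_ \in _); rewrite ?normr1 ?normr0//.
have near := cube_near_origin; rewrite -/A in near.
have bnd k s : \int[mu]_(x in Q) (s * \1_A x + 0 * \1_A x + k) =
    s * \int[mu]_(x in Q) \1_A x + k * vol.
  by rewrite (Rintegral_affine mQ muQ iA iA) mul0r addr0.
have : \int[mu]_(x in Q) (p x)^-1 <=
    Cinf * \int[mu]_(x in Q) \1_A x + (pinf^-1 + Cinf * (2 / ln S)) * vol.
  rewrite -bnd; apply: ae_le_Rintegral => //.
    exact: (integrable_affine mQ muQ iA iA).
  by apply: aeW => x _; have := ptw x; rewrite ler_distl; lra.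
have : - Cinf * \int[mu]_(x in Q) \1_A x + (pinf^-1 - Cinf * (2 / ln S)) * vol <=
    \int[mu]_(x in Q) (p x)^-1.
  rewrite -bnd; apply: ae_le_Rintegral => //.
    exact: (integrable_affine mQ muQ iA iA).
  by apply: aeW => x _; have := ptw x; rewrite ler_distl; lra.
have avgE : \int[mu]_(x in Q) (p x)^-1 = avg_pV * vol.
  by rewrite /avg_pV divfK// gt_eqF.
have nearC : Cinf * \int[mu]_(x in Q) \1_A x <= Cinf * (11 / ln S * vol).
  by rewrite ler_pM2l.
rewrite avgE => lo hi; rewrite ler_distl.
rewrite -(ler_pM2r vol0) -[X in _ && X](ler_pM2r vol0).
have -> : 13 * Cinf / ln S = Cinf * (2 / ln S) + Cinf * (11 / ln S).
  by field; rewrite gt_eqF.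
exact: average_deviation nearC lo hi.
Qed.

Section large_cubes.
Hypothesis llarge : 1 <= 4 * n%:R ^+ 2 * l.

Let a := log_dim R n.
Let d := doubling_exp (n := n) h.

Lemma log_dim_ge1 : 1 <= log_dim R n.
Proof.
by rewrite lerDl ln_ge0// lerDr mulr_ge0// exprn_ge0.
Qed.

Lemma ln_dim_mul_le y : expR 1 <= y -> ln ((4 * n%:R ^+ 2 + 1) * y) <= a * ln y.
Proof.
move=> ye; have y0 : 0 < y by apply: lt_le_trans ye; exact: expR_gt0.
have n4 : 1 <= 4 * n%:R ^+ 2 + 1 :> R by rewrite lerDr mulr_ge0// exprn_ge0.
rewrite lnM ?posrE//.
have := ln_ge1 ye; have := ln_ge0 n4; rewrite /a /log_dim.
move: (ln (4 * _ + _)) (ln y) => u v u0 v1.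
have : 0 <= u * (v - 1) by rewrite mulr_ge0// subr_ge0.
lra.
Qed.

Lemma ln_vol_ge : - (n%:R * a) <= ln vol.
Proof.
have n4 : 0 < 4 * n%:R ^+ 2 + 1 :> R.
  by rewrite ltr_wpDl// mulr_ge0// exprn_ge0.
have lV : l^-1 <= 4 * n%:R ^+ 2 + 1.
  by rewrite -div1r ler_pdivrMr// mulrDl mul1r; have l1 := l0; have l2 := llarge; lra.
have : ln l^-1 <= a.
  rewrite (@le_trans _ _ (ln (4 * n%:R ^+ 2 + 1)))//; last by rewrite /a /log_dim; lra.
  by rewrite ler_ln ?posrE ?invr_gt0.
rewrite lnV ?posrE// => la.
by rewrite /vol lnXn// -[leRHS]mulr_natl -mulrN ler_wpM2l// lerNl.
Qed.

(** Decay exponent for the error term of [expR_exponent_swap]: [n + 1] makes it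
    integrable, and the last term accounts for volumes below [1]. *)
Definition indic_rate : R := n%:R + 1 + n%:R * a.
Definition indic_cost : R := ln (expR (indic_rate * Cinf) + 2 * (2 * expR 1) ^+ n).

Lemma indic_rate_ge0 : 0 <= indic_rate.
Proof.
by rewrite !addr_ge0// mulr_ge0// (le_trans ler01)// log_dim_ge1.
Qed.

Lemma indic_cost_ge0 : 0 <= indic_cost.
Proof.
have [_ [_ _ Cinf0] _ _] := pLH.
rewrite ln_ge0// -[leLHS]addr0 lerD ?mulr_ge0 ?exprn_ge0 ?expR_ge0//.
by rewrite -[leLHS]expR0 ler_expR mulr_ge0 ?indic_rate_ge0// ltW.
Qed.

(** The modular of the indicator is compared with the same modular for the constant
    exponent [pinf], which is a power of the volume. *)
Lemma large_cube_indic_norm :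
  ((expR (ln vol / pinf - indic_cost))%:E <= Lp_norm p \1_Q)%E.
Proof.
apply: (Lp_norm_indic_ge (Q := Q) p1) => b hb.
have N0 := indic_rate_ge0.
have Nb : - indic_rate <= b.
  apply: (modular_indic_le1 (p := p) mQ (measurable_funTS mp) muQ vol0 p1 _ hb).
  move=> x _; apply: le_trans ln_vol_ge; rewrite mulNr lerN2.
  have : indic_rate * 1 <= indic_rate * p x by rewrite ler_wpM2l.
  by have n01 : 0 <= n%:R :> R by []; rewrite {1}/indic_rate; lra.
have mexp := measurable_size_power indic_rate (R := R) (n := n).
have ptw x : expR (- b * pinf) <=
    expR (indic_rate * Cinf) * expR (- b * p x) + 1 * expR (- (indic_rate * lnsize x)).
  rewrite mul1r; have u1 := lnsize_ge1 x.
  apply: expR_exponent_swap => //.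
  - exact: lt_le_trans u1.
  - rewrite lerNl (le_trans _ Nb)// lerN2 ler_peMr//.
  - by rewrite distrC; exact: p_at_infinity pLH x.
have mbp : measurable_fun Q (fun x => expR (- b * p x)).
  apply: (measurableT_comp (f := @expR R)) => //.
  by apply: measurable_funM => //; exact: measurable_funTS.
have [J QJ] := cube_subset_dyadic.
have tail : (\int[mu]_(x in Q) (expR (- (indic_rate * lnsize x)))%:E <=
    (2 * (2 * expR 1) ^+ n)%:E)%E.
  have e0 : (0 : R) < expR 1 := expR_gt0 _.
  have l20 : 0 <= ln (2 : R) by rewrite ln_ge0// ler1n.
  have F00 : 0 <= (2 * expR 1) ^+ n :> R.
    by rewrite exprn_ge0// mulr_ge0// ltW.
  have d0 : 0 <= n%:R * ln 2 :> R by rewrite mulr_ge0.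
  have dN : n%:R * ln 2 + ln 2 <= indic_rate * ln 2.
    rewrite -[X in _ + X]mul1r -mulrDl ler_wpM2r// /indic_rate lerDl.
    by rewrite mulr_ge0// (le_trans ler01)// log_dim_ge1.
  have m1 : measurable_fun [set: Rn R n] (fun=> 1 : R) by exact: measurable_cst.
  have vE j : (\int[mu]_(x in cball origin (2 ^+ j * expR 1)) 1%:E <=
      (expR (j%:R * (n%:R * ln 2)) * (2 * expR 1) ^+ n)%:E)%E.
    rewrite integral_cst//=; last exact: measurable_cball.
    rewrite lebesgue_cball ?mulr_gt0 ?exprn_gt0// mul1e lee_fin.
    by rewrite !expRM_natl lnK ?posrE// mulrCA exprMn -exprM mulnC exprM.
  have := polynomial_tail m1 (fun=> ler01) F00 d0 dN vE mQ QJ.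
  by under eq_integral do rewrite mul1r.
have ptw_ae : \forall x \ae mu, Q x -> expR (- b * pinf) <=
    expR (indic_rate * Cinf) * expR (- b * p x) + 1 * expR (- (indic_rate * lnsize x)).
  by apply: aeW => x _; exact: ptw.
have mk : measurable_fun Q (fun=> expR (- b * pinf)) by exact: measurable_cst.
have := ae_ge0_le_integral_lincomb mQ mk mbp
  (measurable_funTS mexp) (fun=> expR_ge0 _) (fun=> expR_ge0 _) (fun=> expR_ge0 _)
  (expR_ge0 (indic_rate * Cinf)) ler01 ptw_ae.
rewrite integral_cst//= muQ mul1e => hI.
have {hI} hI : expR (- b * pinf) * vol <= expR indic_cost.
  rewrite -lee_fin EFinM (le_trans hI)// lnK; last first.
    rewrite posrE addr_gt0 ?expR_gt0// mulr_gt0// exprn_gt0// mulr_gt0// expR_gt0.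
  rewrite EFinD leeD// -[leRHS]mule1 lee_wpmul2l// lee_fin expR_ge0.
have k0 := indic_cost_ge0; have pinf_ge := pinf1.
have pinf0 : 0 < pinf by lra.
rewrite -[X in _ * X](lnK vol0) -expRD ler_expR in hI.
have h1 : ln vol / pinf <= b + indic_cost / pinf.
  by rewrite ler_pdivrMr// mulrDl divfK ?gt_eqF//; lra.
have : indic_cost / pinf <= indic_cost.
  by rewrite ler_pdivrMr// ler_peMr.
lra.
Qed.

(** The analogue of [indic_rate] for the measure of density [W]: the first term
    controls the ratio of the masses of [Q0] and [Q], the second one makes the error
    term integrable against [W]. *)
Definition weight_rate : R := 4 * d * a + (2 * d + 1).

Let d1 : 1 <= d. Proof. exact: doubling_exp_ge1 wW Wh. Qed.
Let a1 : 1 <= a. Proof. exact: log_dim_ge1. Qed.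

Lemma weight_rate_ge0 : 0 <= weight_rate.
Proof.
have d_ge0 := le_trans ler01 d1; have a_ge0 := le_trans ler01 a1.
by rewrite !addr_ge0 ?mulr_ge0.
Qed.

(** Doubling on the ball about the center of [Q] that reaches [Q0]: its radius is
    controlled by the size of any point [x] of [Q], because the edge is not small. *)
Lemma mass_Q0_le_lnsize x : Q x ->
  ln (mass W Q0) - ln (mass W Q) <= weight_rate * lnsize x.
Proof.
move=> Qx; have xe := size_ge_e x; have e0 := expR_gt0 (1 : R).
have x0 : 0 <= expR 1 + supnorm x by exact: le_trans (ltW e0) xe.
have l_gt0 := l0; have d_ge0 := le_trans ler01 d1.
have n4 : 1 <= 4 * n%:R ^+ 2 + 1 :> R by rewrite lerDr mulr_ge0// exprn_ge0.
set y := (4 * n%:R ^+ 2 + 1) * (expR 1 + supnorm x).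
have ye : expR 1 <= y.
  by rewrite (le_trans xe)// ler_peMl.
have yl : supnorm c + expR 1 <= y * l.
  have l20 : 0 <= l / 2 by rewrite divr_ge0// ltW.
  have := supnorm_cball l20 (cball_sym (Qc Qx)).
  have -> : y * l = (4 * n%:R ^+ 2 * l) * (expR 1 + supnorm x)
      + l * (expR 1 + supnorm x) by rewrite /y; ring.
  have : 1 * (expR 1 + supnorm x) <= (4 * n%:R ^+ 2 * l) * (expR 1 + supnorm x).
    by rewrite ler_wpM2r.
  have : l * 1 <= l * (expR 1 + supnorm x).
    by apply: ler_wpM2l; [exact: ltW|exact: le_trans (expR1_ge1 R) xe].
  lra.
have := ln_mass_Q0_le wW Wh cQ mQ l0 muQ Qc ye yl.
rewrite -/d; have := ln_dim_mul_le xe; rewrite -/y -/(lnsize x) => la.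
have : 4 * d * ln y <= 4 * d * (a * lnsize x) by rewrite ler_wpM2l// mulr_ge0.
have : 0 <= (2 * d + 1) * lnsize x.
  by rewrite mulr_ge0 ?(le_trans ler01 (lnsize_ge1 x))// addr_ge0// mulr_ge0.
rewrite /weight_rate; move: (lnsize x) (ln y) (ln _) (ln _) d a => u v w1 w2 d' a'.
lra.
Qed.

Section large_weight.
Variables (pm pp : R).
Hypothesis pV_ae : \forall x \ae mu, pp^-1 <= (p x)^-1 <= pm^-1.

(** The weight is normalized by its mass over [Q0], to which the tail of the integral
    is comparable.  With [tau] the logarithm of the ratio of the two masses, divided
    by [pinf], the exponent [p] can be replaced by [pinf] because [expR tau] is at most
    a power of the size of each point of [Q]. *)
Lemma large_cube_weight_norm :
  (Lp_norm p (fun x => W x `^ (p x)^-1 * \1_Q x)%R <=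
   (expR (weight_rate * Cinf + 2 + avg_pV * ln (mass W Q0) + Q0_cost pm pp +
     (ln (mass W Q) - ln (mass W Q0)) / pinf))%:E)%E.
Proof.
set bw := (X in expR X).
apply: (Lp_norm_powR_le (Q := Q) p1 W0).
have [_ [_ _ Cinf0] _ _] := pLH.
have N0 := weight_rate_ge0; have pinf_ge := pinf1.
have pinf0 : 0 < pinf by exact: lt_le_trans pinf_ge.
have w0 := mass_gt0; have w00 := mass_Q0_gt0 Wh.
have [Wi _ _ _] := Wh cQ mQ muQ vol0.
set N := weight_rate in N0 bw *.
pose tau := (ln (mass W Q0) - ln (mass W Q)) / pinf.
pose B := expR (- (N * Cinf + 2)) / mass W Q0.
have B0 : 0 <= B by rewrite divr_ge0 ?expR_ge0// ltW.
have tauN x : Q x -> tau <= N * lnsize x.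
  move=> Qx; have h1 := mass_Q0_le_lnsize Qx.
  rewrite /tau ler_pdivrMr//; apply: (le_trans h1).
  by rewrite ler_peMr// mulr_ge0// (le_trans ler01)// lnsize_ge1.
have mbp : measurable_fun Q (fun x => W x * expR (- bw * p x)).
  apply: measurable_funM; first exact: measurable_funTS.
  apply: (measurableT_comp (f := @expR R)) => //.
  by apply: measurable_funM => //; exact: measurable_funTS.
have mWQ : measurable_fun Q W by exact: measurable_funTS.
have mexp : measurable_fun Q (fun x => W x * expR (- (N * lnsize x))).
  by apply: measurable_funM => //; apply: measurable_funTS; exact: measurable_size_power.
have ptw : \forall x \ae mu, Q x -> W x * expR (- bw * p x) <=
    (B * (expR (N * Cinf) * expR (tau * pinf))) * W x
    + B * (W x * expR (- (N * lnsize x))).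
  apply: filterS (pV_dist_avg pV_ae) => x hx Qx.
  have u1 := lnsize_ge1 x; have p1x := p1 x.
  have p0x : 0 < p x by exact: lt_le_trans p1x.
  have sw : expR (tau * p x) <=
      expR (N * Cinf) * expR (tau * pinf) + expR (- (N * lnsize x)).
    apply: expR_exponent_swap => //; [|exact: tauN|exact: p_at_infinity pLH x].
    exact: lt_le_trans u1.
  have hB : expR (- bw * p x) <= B * expR (tau * p x).
    rewrite /B -[X in _ / X](lnK w00) -expRN -!expRD ler_expR.
    have -> : - bw * p x = - (N * Cinf + 2) * p x
        - (avg_pV * ln (mass W Q0) + Q0_cost pm pp) * p x + tau * p x.
      by rewrite /bw /tau; ring.
    rewrite lerD2r lerD//.
      by rewrite mulNr lerN2 ler_peMr// addr_ge0// mulr_ge0// ltW.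
    rewrite lerN2 -ler_pdivrMr// mulrC.
    by move: hx; rewrite mulrBl lerBlDr addrC.
  have : W x * expR (- bw * p x) <= W x * (B * (expR (N * Cinf) * expR (tau * pinf) +
      expR (- (N * lnsize x)))).
    by rewrite ler_wpM2l// (le_trans hB)// ler_wpM2l.
  by move/le_trans; apply; rewrite le_eqVlt; apply/orP; left; apply/eqP; ring.
have [J QJ] := cube_subset_dyadic.
have tail : (\int[mu]_(x in Q) (W x * expR (- (N * lnsize x)))%:E <=
    (2 * mass W Q0)%:E)%E.
  have l20 := ln2_ge_half R.
  have dN : d + ln 2 <= N * ln 2.
    have h1 : 0 <= 4 * d * a * ln 2.
      by rewrite !mulr_ge0 ?(le_trans ler01 d1) ?(le_trans ler01 a1)// (le_trans _ l20).
    have h2 : d * 2^-1 <= d * ln 2 by rewrite ler_wpM2l// (le_trans ler01 d1).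
    by move: h1 h2; rewrite /N /weight_rate; move: d a (ln 2) => d' a' L; lra.
  apply: (polynomial_tail mW W0 (ltW w00) (le_trans ler01 d1) dN _ mQ QJ) => j.
  have e0 : (0 : R) < expR 1 := expR_gt0 _.
  have r0 : 0 < 2 ^+ j * expR 1 :> R by rewrite mulr_gt0// exprn_gt0.
  have v0 : 0 < (2 * (2 ^+ j * expR 1)) ^+ n :> R by rewrite exprn_gt0// mulr_gt0.
  have [Wij _ wj _] := Wh (is_cube_cball origin r0) (measurable_cball _ _)
    (lebesgue_cball origin r0) v0.
  have -> : (\int[mu]_(x in cball origin (2 ^+ j * expR 1)) (W x)%:E =
      (mass W (cball origin (2 ^+ j * expR 1)))%:E)%E.
    rewrite /mass /Rintegral fineK//; apply: integrable_fin_num => //.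
    exact: measurable_cball.
  rewrite lee_fin -[leLHS](lnK wj) -[X in _ <= _ * X](lnK w00) -expRD ler_expR addrC.
  by rewrite Q0E; exact: (ln_mass_cball_pow wW Wh origin j e0).
have f0 x : 0 <= W x * expR (- bw * p x) by rewrite mulr_ge0// expR_ge0.
have g0 x : 0 <= W x * expR (- (N * lnsize x)) by rewrite mulr_ge0// expR_ge0.
have A0 : 0 <= B * (expR (N * Cinf) * expR (tau * pinf)).
  by rewrite mulr_ge0// mulr_ge0// expR_ge0.
have := ae_ge0_le_integral_lincomb mQ mbp mWQ mexp f0 W0 g0 A0 B0 ptw.
have -> : (\int[mu]_(x in Q) (W x)%:E = (mass W Q)%:E)%E.
  by rewrite /mass /Rintegral fineK//; exact: integrable_fin_num.
move=> /le_trans; apply.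
apply: (@le_trans _ _ ((B * (expR (N * Cinf) * expR (tau * pinf)))%:E * (mass W Q)%:E
    + B%:E * (2 * mass W Q0)%:E)%E).
  by rewrite leeD2l// lee_wpmul2l.
rewrite -!EFinM -EFinD lee_fin.
(* the summand 2 of [bw] absorbs both contributions, as [1 + 2 <= expR 2] *)
have -> : B * (expR (N * Cinf) * expR (tau * pinf)) * mass W Q = expR (- 2).
  rewrite /B /tau divfK ?gt_eqF// -[X in _ * X](lnK w0) -[X in _ / X](lnK w00).
  rewrite -!expRN -!expRD; congr expR; ring.
have -> : B * (2 * mass W Q0) = 2 * expR (- (N * Cinf + 2)).
  by rewrite /B mulrCA divfK// gt_eqF.
have : expR (- (N * Cinf + 2)) <= expR (- 2).
  by rewrite ler_expR lerN2 lerDr mulr_ge0// ltW.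
have : 3 * expR (- 2) <= 1 :> R.
  rewrite expRN ler_pdivrMr ?expR_gt0// mul1r.
  by have := expR_ge1Dx (2 : R); lra.
lra.
Qed.

(** The product of the two norm bounds leaves the factor
    [(w / (w0 * v)) ^ (1 / pinf - s)], which is bounded because [1 / pinf - s] is of the
    order of [1 / ln S] while the masses and the volume are powers of [S]. *)
Lemma large_cube_bound :
  (mule_oo ((Lp_norm p \1_Q)^-1 *
      Lp_norm p (fun x => W x `^ (p x)^-1 * \1_Q x)%R)
    (exp_avg_log_inv (fun x => W x `^ (p x)^-1)%R Q) <=
   (expR (Q0_cost pm pp + (weight_rate * Cinf + 2 + indic_cost
       + 13 * Cinf * (4 * d * a + n%:R * a)) + 1 + h))%:E)%E.
Proof.
apply: (quotient_bound large_cube_weight_norm large_cube_indic_norm).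
have [_ [_ _ Cinf0] _ _] := pLH.
have d_ge0 := le_trans ler01 d1; have a_ge1 := a1; have a_ge0 := le_trans ler01 a1.
have l_gt0 := l0; have e0 := expR_gt0 (1 : R); have e1 := expR1_ge1 R.
have c0 := supnorm_ge0 c; have lnS_ge1 := lnS1; have lnS0 := lt_le_trans ltr01 lnS1.
have n4 : 1 <= 4 * n%:R ^+ 2 + 1 :> R by rewrite lerDr mulr_ge0// exprn_ge0.
set y := (4 * n%:R ^+ 2 + 1) * S.
have Sy : S <= y by rewrite ler_peMl// ltW.
have ye : expR 1 <= y by exact: le_trans Se Sy.
have lny : ln y <= a * ln S by exact: ln_dim_mul_le Se.
have yl : supnorm c + expR 1 <= y * l.
  have -> : y * l = (4 * n%:R ^+ 2 * l) * S + l * S by rewrite /y; ring.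
  have lS : 0 <= l * S by rewrite mulr_ge0 ?ltW.
  have nlS : S <= (4 * n%:R ^+ 2 * l) * S by rewrite ler_peMl// ltW.
  apply: (@le_trans _ _ (S + 0)); last exact: lerD.
  by rewrite addr0 /S [supnorm c + _]addrC lerDl ltW.
have cy : supnorm c + l / 2 <= 2 * expR 1 * y.
  have : 1 * y <= expR 1 * y by rewrite ler_wpM2r// (le_trans _ ye)// ltW.
  by rewrite -mulrA; move: Sy; rewrite /S; lra.
have hQ0 := ln_mass_Q0_le wW Wh cQ mQ l0 muQ Qc ye yl.
have hQ := ln_mass_le_Q0 wW Wh cQ mQ l0 muQ Qc ye cy.
have dlny : 4 * d * ln y <= 4 * d * a * ln S.
  by rewrite -[leRHS]mulrA ler_wpM2l// mulr_ge0.
have lnvol : ln vol <= n%:R * a * ln S.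
  rewrite /vol lnXn// -[leLHS]mulr_natl -mulrA ler_wpM2l//.
  apply: (@le_trans _ _ (ln S)); last by rewrite ler_peMl// ltW.
  by rewrite ler_ln ?posrE// /S lerDr addr_ge0// ltW.
have lnvol' : - (n%:R * a * ln S) <= ln vol.
  apply: le_trans ln_vol_ge; rewrite lerN2 ler_peMr// mulr_ge0//.
have key : (pinf^-1 - avg_pV) * (ln (mass W Q) - ln (mass W Q0) - ln vol) <=
    13 * Cinf * (4 * d * a + n%:R * a).
  rewrite (le_trans (ler_norm _))// normrM distrC.
  have -> : 13 * Cinf * (4 * d * a + n%:R * a) =
      13 * Cinf / ln S * ((4 * d * a + n%:R * a) * ln S).
    by field; rewrite gt_eqF.
  apply: ler_pM => //; first exact: avg_pV_limit.
  move: hQ0 hQ dlny lnvol lnvol'; rewrite -/d ler_norml.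
  move: (ln (mass W Q)) (ln (mass W Q0)) (ln vol) (4 * d * ln y) (ln S).
  move: (4 * d * a) (n%:R * a) => u v x1 x2 x3 x4 x5 h1 h2 h3 h4 h5.
  by apply/andP; split; lra.
rewrite ln_div ?posrE//.
move: key; move: (ln (mass W Q)) (ln (mass W Q0)) (ln vol) => x1 x2 x3.
move: (13 * Cinf * (4 * d * a + n%:R * a)) (weight_rate * Cinf) indic_cost => u v w.
move: (Q0_cost pm pp) avg_pV => cost s key.
lra.
Qed.

End large_weight.
End large_cubes.
End cube_bounds.

(** * Uniform bound and conclusion *)

(** The bounds for small and for large cubes are affine functions of the doubling
    exponent [g + b * h]; this coefficient is large enough for both. *)
Definition growth_slope (R : realType) (a C0 Cinf : R) : R :=
  16 * (C0 + Cinf) + (4 * a + 2) * Cinf + 52 * Cinf * a.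

Lemma small_bound_affine (R : realType) (g b h N a k C0 Cinf : R) :
  0 <= g + b * h -> 0 <= a -> 0 <= N -> 0 <= k -> 0 <= C0 -> 0 <= Cinf ->
  (4 * (g + b * h) + N) * (4 * (C0 + Cinf)) + 1 + h <=
  g * growth_slope a C0 Cinf + N * (4 * (C0 + Cinf)) + (Cinf + 3 + k + 13 * Cinf * (N * a))
  + (b * growth_slope a C0 Cinf + 1) * h.
Proof.
move=> d0 a0 N0 k0 C00 Cinf0.
have Ca : 0 <= Cinf * a by rewrite mulr_ge0.
have : 0 <= (g + b * h) * ((4 * a + 2) * Cinf + 52 * Cinf * a).
  by rewrite mulr_ge0//; lra.
have : 0 <= N * (Cinf * a) by rewrite mulr_ge0.
rewrite /growth_slope; lra.
Qed.

Lemma large_bound_affine (R : realType) (g b h N a k C0 Cinf : R) :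
  0 <= g + b * h -> 0 <= N -> 0 <= C0 -> 0 <= Cinf ->
  ((4 * (g + b * h) * a + (2 * (g + b * h) + 1)) * Cinf + 2 + k
   + 13 * Cinf * (4 * (g + b * h) * a + N * a)) + 1 + h <=
  g * growth_slope a C0 Cinf + N * (4 * (C0 + Cinf)) + (Cinf + 3 + k + 13 * Cinf * (N * a))
  + (b * growth_slope a C0 Cinf + 1) * h.
Proof.
move=> d0 N0 C00 Cinf0.
have : 0 <= (g + b * h) * (16 * (C0 + Cinf)) by rewrite mulr_ge0//; lra.
have : 0 <= N * (C0 + Cinf) by rewrite mulr_ge0//; lra.
rewrite /growth_slope; lra.
Qed.

Section final_bound.
Context {R : realType} {n : nat}.
Local Notation mu := (@lebesgue R n).

Definition bound_exponent (C0 Cinf : R) : R := 2 ^+ n * growth_slope (log_dim R n) C0 Cinf + 1.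

Definition bound_log_constant (C0 Cinf : R) : R :=
  (1 + n%:R * ln 2) * growth_slope (log_dim R n) C0 Cinf + n%:R * (4 * (C0 + Cinf)) +
  (Cinf + 3 + indic_cost (n := n) Cinf + 13 * Cinf * (n%:R * log_dim R n)).

Lemma log_dim_ge0 : 0 <= log_dim R n.
Proof. by rewrite (le_trans ler01)// log_dim_ge1. Qed.

Lemma growth_slope_ge0 C0 Cinf : 0 < C0 -> 0 < Cinf -> 0 <= growth_slope (log_dim R n) C0 Cinf.
Proof.
move=> C00 Cinf0; rewrite /growth_slope; move: (log_dim R n) log_dim_ge0 => a a0.
by have := mulr_ge0 (ltW Cinf0) a0; lra.
Qed.

Lemma bound_exponent_gt0 C0 Cinf : 0 < C0 -> 0 < Cinf -> 0 < bound_exponent C0 Cinf.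
Proof.
by move=> C00 Cinf0; rewrite ltr_wpDl// mulr_ge0 ?exprn_ge0// growth_slope_ge0.
Qed.

Lemma ae_lebesgue_ex (P : Rn R n -> Prop) : (\forall x \ae mu, P x) -> exists x, P x.
Proof.
move=> [N [mN N0 PN]]; apply: contrapT => nP.
have r1 : (0 : R) < 1 by [].
have : (mu (cball origin 1) <= mu N)%E.
  apply: le_measure; rewrite ?inE//; first exact: measurable_cball.
  by move=> x _; apply: PN => Px; apply: nP; exists x.
by rewrite lebesgue_cball// N0 lee_fin leNgt exprn_gt0// mulr_gt0.
Qed.

Section bound.
Variables (p : Rn R n -> R) (C0 pinf Cinf pm pp : R).
Hypotheses (n0 : (0 < n)%N)
  (p_exp : exponent (fun x => (p x)%:E)) (pLH : LH_with p C0 pinf Cinf)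
  (pmE : p_minus p = pm%:E) (ppE : p_plus p = pp%:E).

Lemma pV_ae_bounds : \forall x \ae mu, pp^-1 <= (p x)^-1 <= pm^-1.
Proof.
have pm1 : 1 <= pm.
  rewrite -lee_fin -pmE; apply/ess_infP; apply: aeW => x /=.
  by rewrite lee_fin (p_ge1 p_exp).
have hm := ess_inf_le mu (EFin \o p); rewrite -/(p_minus p) pmE in hm.
have hp := ess_sup_ge mu (EFin \o p); rewrite -/(p_plus p) ppE in hp.
apply: filterS2 hm hp => x /=; rewrite !lee_fin => hm hp.
have p0 : 0 < p x by apply: lt_le_trans (p_ge1 p_exp x).
by rewrite !lef_pV2 ?posrE ?hm ?hp// (lt_le_trans _ hp, lt_le_trans _ pm1).
Qed.

Lemma Apinfty_const_le W H : weight W -> 0 < H -> log_A_infty W (ln H) ->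
  (Apinfty_const p (fun x => W x `^ (p x)^-1)%R <=
   (expR (Q0_cost W pm pp + bound_log_constant C0 Cinf +
     bound_exponent C0 Cinf * ln H))%:E)%E.
Proof.
move=> wW H0 Wh.
have h0 : 0 <= ln H by exact: log_A_infty_ge0 wW Wh.
have [_ [C00 _ Cinf0] _ _] := pLH.
have a0 := log_dim_ge0.
have kap := indic_cost_ge0 pLH.
apply: ge_ereal_sup => _ [Q cQ <-].
have [c [l [l0 Qc mQ muQ]]] := is_cube_data cQ.
have d0 : 0 <= doubling_exp (n := n) (ln H).
  by rewrite (le_trans ler01)// (doubling_exp_ge1 wW Wh).
have n_ge0 : 0 <= n%:R :> R by [].
have [ls|/ltW ll] := leP (4 * n%:R ^+ 2 * l) 1.
- apply: le_trans (small_cube_bound n0 p_exp pLH wW Wh cQ mQ l0 muQ Qc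
    pV_ae_bounds ls) _.
  rewrite lee_fin ler_expR -[leLHS]addrA -[leLHS]addrA -[leRHS]addrA lerD2l addrA.
  exact: small_bound_affine d0 a0 n_ge0 kap (ltW C00) (ltW Cinf0).
- apply: le_trans (large_cube_bound n0 p_exp pLH wW Wh cQ mQ l0 muQ Qc ll
    pV_ae_bounds) _.
  rewrite lee_fin ler_expR -[leLHS]addrA -[leLHS]addrA -[leRHS]addrA lerD2l addrA.
  exact: large_bound_affine d0 n_ge0 (ltW C00) (ltW Cinf0).
Qed.

End bound.
End final_bound.

Section weight_of_power.
Context {R : realType} {n : nat}.
Local Notation mu := (@lebesgue R n).
Variables (p : Rn R n -> R) (C0 pinf Cinf : R).
Hypotheses (p_exp : exponent (fun x => (p x)%:E)) (pLH : LH_with p C0 pinf Cinf).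

Lemma weight_powR W : weight W -> weight (fun x => W x `^ (p x)^-1).
Proof.
move=> [mW W0 Wae]; split.
- apply: (measurable_fun_powR mW (measurable_pV p_exp pLH)) => x.
  by rewrite invr_eq0 gt_eqF// (lt_le_trans _ (p_ge1 p_exp x)).
- by move=> x; exact: powR_ge0.
- by apply: filterS Wae => x Wx; exact: powR_gt0.
Qed.

(** The condition at infinity bounds the exponent. *)
Lemma ess_bounds_real : exists pm pp, p_minus p = pm%:E /\ p_plus p = pp%:E.
Proof.
have [_ [_ _ Cinf0] _ _] := pLH.
have pB x : p x <= pinf + Cinf.
  have : Cinf / lnsize x <= Cinf.
    by rewrite ler_pdivrMr ?ler_peMr ?(ltW Cinf0) ?(lt_le_trans ltr01) ?lnsize_ge1.
  have := p_at_infinity pLH x; rewrite ler_distl; lra.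
exists (fine (p_minus p)), (fine (p_plus p)); split; rewrite fineK// fin_numElt.
- apply/andP; split.
    apply: (@lt_le_trans _ _ 1%:E); first exact: ltNyr.
    by apply/ess_infP; apply: aeW => x /=; rewrite lee_fin (p_ge1 p_exp).
  have [x hx] := ae_lebesgue_ex (ess_inf_le mu (EFin \o p)).
  exact: le_lt_trans hx (ltry _).
- apply/andP; split.
    have [x hx] := ae_lebesgue_ex (ess_sup_ge mu (EFin \o p)).
    exact: lt_le_trans (ltNyr _) hx.
  apply: (@le_lt_trans _ _ (pinf + Cinf)%:E); last exact: ltry.
  by apply/ess_supP; apply: aeW => x /=; rewrite lee_fin.
Qed.

Lemma expR_Q0_cost_le W h pm pp : weight W -> log_A_infty W h ->
  p_minus p = pm%:E -> p_plus p = pp%:E ->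
  ((expR (Q0_cost W pm pp))%:E <= Ltilde p W)%E.
Proof.
move=> wW Wh pmE ppE; have w0 := mass_Q0_gt0 Wh.
have vE : (\int[mu]_(x in Q0) (W x)%:E = (mass W Q0)%:E)%E.
  have e0 : (0 : R) < expR 1 := expR_gt0 _.
  have v0 : 0 < (2 * expR 1) ^+ n :> R by rewrite exprn_gt0// mulr_gt0.
  have [Wi _ _ _] := Wh _ _ (is_cube_cball origin e0) (measurable_cball _ _)
    (lebesgue_cball origin e0) v0.
  rewrite Q0E /mass /Rintegral fineK//; apply: integrable_fin_num => //.
  exact: measurable_cball.
rewrite /Ltilde pmE ppE /= vE /= le_max !lee_fin /powR gt_eqF// !ler_expR.
rewrite /Q0_cost; have [l0|/ltW l0] := leP 0 (ln (mass W Q0)).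
  by rewrite ger0_norm// lexx.
by apply/orP; right; rewrite ler0_norm// mulrN -mulNr opprB.
Qed.

End weight_of_power.

Theorem proposition2p30 (R : realType) (n : nat) (n_gt0 : (0 < n)%N) :
  (forall p : Rn R n -> R, exponent (fun x => (p x)%:E) -> LH p ->
     forall W : Rn R n -> R, Ainfty W ->
     Apinfty p (fun x => W x `^ (p x)^-1)) /\
  (forall pm pp pinf C0 Cinf : R,
     exists C A : R, [/\ 0 < C, 0 < A &
       forall p : Rn R n -> R, exponent (fun x => (p x)%:E) ->
         LH_with p C0 pinf Cinf ->
         p_minus p = pm%:E -> p_plus p = pp%:E ->
       forall W : Rn R n -> R, Ainfty W ->
         (Apinfty_const p (fun x => W x `^ (p x)^-1)%R
            <= C%:E * Ltilde p W * Ainfty_const W `^ A)%E]).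
Proof.
split.
  move=> p p_exp [C0 [pinf [Cinf pLH]]] W AW.
  have [wW _] := AW; have [H [_ H0 Wh]] := Ainfty_log AW.
  have [pm [pp [pmE ppE]]] := ess_bounds_real p_exp pLH.
  split; first exact: weight_powR pLH _ wW.
  by apply: le_lt_trans (Apinfty_const_le n_gt0 p_exp pLH pmE ppE wW H0 Wh) (ltry _).
move=> pm pp pinf C0 Cinf.
have [/andP[C00 Cinf0]|neg] := boolP ((0 < C0) && (0 < Cinf)); last first.
  (* no exponent satisfies the conditions with such constants *)
  exists 1, 1; split=> // p _ [_ [C00 _ Cinf0] _ _].
  by rewrite C00 Cinf0 in neg.
exists (expR (bound_log_constant (n := n) C0 Cinf)), (bound_exponent (n := n) C0 Cinf).
split; [exact: expR_gt0|exact: bound_exponent_gt0|].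
move=> p p_exp pLH pmE ppE W AW.
have [wW _] := AW; have [H [HE H0 Wh]] := Ainfty_log AW.
apply: (le_trans (Apinfty_const_le n_gt0 p_exp pLH pmE ppE wW H0 Wh)).
rewrite HE poweR_EFin /powR gt_eqF// !expRD (mulrC (expR (Q0_cost _ _ _))) !EFinM.
rewrite lee_wpmul2r ?lee_fin ?expR_ge0// lee_wpmul2l ?lee_fin ?expR_ge0//.
exact: expR_Q0_cost_le wW Wh pmE ppE.
Qed.
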